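(* Let $X$ and $Y$ be real Banach spaces, $P$ a metric space, $I=\{1,\dots,m\}$, and let $F\colon X\times P\to Y$ and $g_i\colon X\times P\to\mathbb{R}$, $i\in I$, be continuous. Let $(\overline{x},\overline{p})\in X\times P$ be such that $\overline{x}\in\mathcal{S}(\overline{p})$, i.e. $F(\overline{x},\overline{p})=\mathbb{O}$ and $g_i(\overline{x},\overline{p})\le 0$ for all $i\in I$, and let $I(\overline{x},\overline{p})=\{i\in I: g_i(\overline{x},\overline{p})=0\}$. Suppose there exists a neighbourhood $U$ of $(\overline{x},\overline{p})$ such that: 1. for any $(x,p)\in U$ the mapping $F(\cdot,p)$ is scalarly quasidifferentiable at $x$, and the functions $g_i(\cdot,p)$, $i\in I(\overline{x},\overline{p})$, are quasidifferentiable at $x$ (with given scalar quasidifferentials $\mathscr{D}_xF(x,p;y^* )$, $y^*\in Y^*$, and quasidifferentials $\mathscr{D}_xg_i(x,p)$); 2. the multifunctions $(x,p)\mapsto\mathscr{D}_xg_i(x,p)$, $i\in I(\overline{x},\overline{p})$, are outer semicontinuous at $(\overline{x},\overline{p})$, and the multifunction $(x,p)\mapsto[\mathscr{D}_xF(x,p;y^* )]^+$ is outer semicontinuous at $(\overline{x},\overline{p})$ uniformly with respect to $y^*\in S_{Y^*}$, i.e. for any $\varepsilon>0$ there exists $\delta>0$ such that $[\mathscr{D}_xF(x,p;y^* )]^+\subseteq[\mathscr{D}_xF(\overline{x},\overline{p};y^* )]^++B(\mathbb{O},\varepsilon)$ for all $y^*\in S_{Y^*}$ and $(x,p)\in B(\overline{x},\delta)\times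 B(\overline{p},\delta)$; 3. for any $y\in S_Y$ the set $D(y)=\bigcup\{[\mathscr{D}_xF(\overline{x},\overline{p};y^* )]^+ : y^*\in S_{Y^*},\ \langle y^*,y\rangle=\|y\|\}$ is weak$^*$ closed and convex. Suppose, finally, that q.d.-MFCQ holds at $(\overline{x},\overline{p})$. Then there exist $K>0$, a neighbourhood $V$ of $(\overline{x},\overline{p})$, and a neighbourhood $W$ of zero in $Y\times\mathbb{R}^m$ such that $$d\big(x,\mathcal{S}(p,y,z)\big)\le K\Big(\|F(x,p)-y\|+\sum_{i=1}^m\max\{g_i(x,p)-z_i,0\}\Big)$$ for all $(x,p)\in V$ and $(y,z)\in W$. In particular, the set-valued mapping $\Phi_p\colon X\rightrightarrows Y\times\mathbb{R}^m$, $\Phi_p(x)=\{F(x,p)\}\times\prod_{i=1}^m[g_i(x,p),+\infty)$, is metrically regular near the point $(\overline{x},(\mathbb{O}_Y,\mathbf{0}_m))$ with the norm of metric regularity not exceeding $K$ for all $p$ in a neighbourhood of $\overline{p}$.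
   Context: Notation: $\mathbb{O}$ is the zero vector of a vector space, $\mathbf{0}_m$ is the zero of $\mathbb{R}^m$; $X^*$, $Y^*$ are topological duals with dual norms; $S_E=\{e\in E:\|e\|=1\}$ for a normed space $E$; $B(a,r)$ is the closed ball; $d(a,C)=\inf_{c\in C}d(a,c)$, $d(a,\emptyset)=+\infty$. For $p\in P$, $y\in Y$, $z=(z_1,\dots,z_m)\in\mathbb{R}^m$, $$\mathcal{S}(p,y,z)=\{x\in X: F(x,p)=y,\ g_i(x,p)\le z_i,\ i\in I\},\qquad \mathcal{S}(p)=\mathcal{S}(p,\mathbb{O}_Y,\mathbf{0}_m).$$ The space $Y\times\mathbb{R}^m$ is equipped with the norm $\|(y,z)\|=\|y\|+\sum_{i=1}^m|z_i|$. Quasidifferentiability. A real-valued function $f$ defined on an open subset of $X$ is quasidifferentiable at $x$ if for all $h\in X$ the finite limit $f'(x,h)=\lim_{\alpha\to+0}(f(x+\alpha h)-f(x))/\alpha$ exists and there is a pair $\mathscr{D}f(x)=[\underline{\partial}f(x),\overline{\partial}f(x)]$ (a quasidifferential of $f$ at $x$) of (nonempty) convex weak$^*$ compact subsets of $X^*$ with $f'(x,h)=\max_{v^*\in\underline{\partial}f(x)}\langle v^*,h\rangle+\min_{w^*\in\overline{\partial}f(x)}\langle w^*,h\rangle$ for all $h\in X$. A mapping $G$ from an open subset of $X$ to $Y$ is scalarly quasidifferentiable at $x$ if for all $h\in X$ the limit $G'(x,h)=\lim_{\alpha\to+0}(G(x+\alpha h)-G(x))/\alpha$ exists in $Y$ and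 for every $y^*\in Y^*$ there is a pair $\mathscr{D}G(x;y^* )=[\underline{\partial}G(x;y^* ),\overline{\partial}G(x;y^* )]$ (a scalar quasidifferential of $G$ at $x$ corresponding to $y^*$) of (nonempty) convex weak$^*$ compact subsets of $X^*$ with $\langle y^*,G'(x,h)\rangle=\max_{v^*\in\underline{\partial}G(x;y^* )}\langle v^*,h\rangle+\min_{w^*\in\overline{\partial}G(x;y^* )}\langle w^*,h\rangle$ for all $h\in X$. Quasidifferentials are not unique; whenever (scalar) quasidifferentiability is assumed, a choice of quasidifferentials is assumed given, and all conditions refer to this choice. $\mathscr{D}_xg_i(x,p)=[\underline{\partial}_xg_i(x,p),\overline{\partial}_xg_i(x,p)]$ and $\mathscr{D}_xF(x,p;y^* )=[\underline{\partial}_xF(x,p;y^* ),\overline{\partial}_xF(x,p;y^* )]$ denote the chosen quasidifferential of $g_i(\cdot,p)$ and scalar quasidifferential of $F(\cdot,p)$ at $x$. Quasidifferential sums: $[\mathscr{D}_xg_i(x,p)]^+=\underline{\partial}_xg_i(x,p)+\overline{\partial}_xg_i(x,p)$ and $[\mathscr{D}_xF(x,p;y^* )]^+=\underline{\partial}_xF(x,p;y^* )+\overline{\partial}_xF(x,p;y^* )$ (Minkowski sums). Outer semicontinuity: $\mathscr{D}_xg_i$ is outer semicontinuous at $(\overline{x},\overline{p})$ if for any (norm) open sets $V_1,V_2\subset X^*$ with $\underline{\partial}_xg_i(\overline{x},\overline{p})\subset V_1$ and $\overline{\partial}_xg_i(\overline{x},\overline{p})\subset V_2$ there is $\delta>0$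 such that $\underline{\partial}_xg_i(x,p)\subset V_1$ and $\overline{\partial}_xg_i(x,p)\subset V_2$ for all $(x,p)\in U$ within distance less than $\delta$ of $(\overline{x},\overline{p})$. q.d.-MFCQ (Mangasarian-Fromovitz constraint qualification in terms of quasidifferentials) holds at $(\overline{x},\overline{p})$ if $$\inf_{y^*\in S_{Y^*}}\inf\{\|v^*\|: v^*\in[\mathscr{D}_xF(\overline{x},\overline{p};y^* )]^+\}>0$$ and there exists $\overline{h}\in X$ such that $\langle v^*,\overline{h}\rangle=0$ for all $v^*\in[\mathscr{D}_xF(\overline{x},\overline{p};y^* )]^+$ and all $y^*\in Y^*$, while $\langle v^*,\overline{h}\rangle<0$ for all $v^*\in[\mathscr{D}_xg_i(\overline{x},\overline{p})]^+$ and $i\in I(\overline{x},\overline{p})$. Metric regularity: a set-valued mapping $\Phi\colon X\rightrightarrows Z$ into a normed space $Z$ is metrically regular near $(\overline{x},\overline{z})$ if there exist $K>0$, $r>0$ with $d(x,\Phi^{-1}(z))\le K\,d(z,\Phi(x))$ for all $(x,z)\in B(\overline{x},r)\times B(\overline{z},r)$, where $\Phi^{-1}(z)=\{x: z\in\Phi(x)\}$; the infimum of all $K$ for which this holds with some $r>0$ is the norm of metric regularity of $\Phi$ near $(\overline{x},\overline{z})$. Here this inequality is used as the definition for $\Phi_p$ also when $(\overline{x},(\mathbb{O}_Y,\mathbf{0}_m))$ does not belong to the graph of $\Phi_p$. *)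

(* Defs.v *)
From HB Require Import structures.
From mathcomp Require Import all_boot all_order all_algebra.
From mathcomp Require Import all_classical all_reals all_analysis.

Set Implicit Arguments.
Unset Strict Implicit.
Unset Printing Implicit Defensive.
Import Order.TTheory GRing.Theory Num.Theory.
Import numFieldNormedType.Exports.

Local Open Scope classical_set_scope.
Local Open Scope ring_scope.

Section dual_space.
Context {R : realType} (X : normedModType R).

Definition dual_pred : {pred (X -> R^o)} :=
  fun f => `[< linear f /\ continuous f >].

Lemma dual_predP (f : X -> R^o) :
  reflect (linear f /\ continuous f) (f \in dual_pred).
Proof. exact: asboolP. Qed.

Lemma dual_submod_closed : submod_closed dual_pred.
Proof.
split.
  apply/dual_predP; split; last by move=> x; exact: cvg_cst.
  by move=> a x y; rewrite /= scaler0 addr0.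
move=> a f g /dual_predP[lf cf] /dual_predP[lg cg]; apply/dual_predP; split.
  move=> b x y.
  have E u : (a *: f + g) u = a *: f u + g u by [].
  rewrite !E lf lg !scalerDr !scalerA (mulrC b a) -!addrA; congr (_ + _).
  by rewrite addrCA.
move=> x; apply: cvgD; last exact: cg.
by apply: cvgZl_tmp; exact: cf.
Qed.

HB.instance Definition _ :=
  GRing.isSubmodClosed.Build R (X -> R^o) dual_pred dual_submod_closed.

(* The topological dual of X: continuous linear functionals on X. *)
Record dual := Dual { dual_fun :> X -> R^o; _ : dual_fun \in dual_pred }.

HB.instance Definition _ := [isSub for dual_fun].
HB.instance Definition _ := [Choice of dual by <:].
HB.instance Definition _ := [SubChoice_isSubLmodule of dual by <:].

Lemma dual_linear (f : dual) : linear f.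
Proof. by case: f => f /= /dual_predP[]. Qed.

Lemma dual_continuous (f : dual) : continuous f.
Proof. by case: f => f /= /dual_predP[]. Qed.

HB.instance Definition _ (f : dual) :=
  GRing.isLinear.Build R X R^o *:%R (dual_fun f) (dual_linear f).

Definition dual_norm (f : dual) : R :=
  sup [set `|f x| | x in [set x : X | `|x| <= 1]].

Let unit_values (f : dual) := [set `|f x| | x in [set x : X | `|x| <= 1]].

Lemma has_sup_unit_values (f : dual) : has_sup (unit_values f).
Proof.
split; first by exists `|f 0|, 0 => //=; rewrite normr0.
have := continuous_linear_bounded (0 : X) (@dual_continuous f 0).
move=> /bounded_funP/(_ 1)[M fM]; exists M => _ [x x1 <-]; exact: fM.
Qed.

Lemma dual_norm_ub (f : dual) (x : X) : `|x| <= 1 -> `|f x| <= dual_norm f.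
Proof. by move=> x1; apply: ub_le_sup; [case: (has_sup_unit_values f)|exists x]. Qed.

Lemma dual_norm_le (f : dual) (c : R) :
  (forall x : X, `|x| <= 1 -> `|f x| <= c) -> dual_norm f <= c.
Proof.
move=> fc; apply: ge_sup; first by case: (has_sup_unit_values f).
by move=> _ [x x1 <-]; exact: fc.
Qed.

Lemma dual_norm_ge0 (f : dual) : 0 <= dual_norm f.
Proof. by apply: (le_trans _ (@dual_norm_ub f 0 _)); rewrite ?normr0. Qed.

Lemma dual_normD (f g : dual) : dual_norm (f + g) <= dual_norm f + dual_norm g.
Proof.
apply: dual_norm_le => x x1.
rewrite (_ : (f + g) x = f x + g x)//.
by rewrite (le_trans (ler_normD _ _))// lerD// dual_norm_ub.
Qed.

Lemma dual_normZ (a : R) (f : dual) : dual_norm (a *: f) = `|a| * dual_norm f.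
Proof.
have leZ (b : R) (h : dual) : dual_norm (b *: h) <= `|b| * dual_norm h.
  apply: dual_norm_le => x x1; rewrite (_ : (b *: h) x = b * h x)//.
  by rewrite normrM ler_wpM2l// dual_norm_ub.
have [->|a0] := eqVneq a 0.
  apply/eqP; rewrite eq_le leZ normr0 mul0r; exact: dual_norm_ge0.
apply/eqP; rewrite eq_le leZ /=.
have := leZ a^-1 (a *: f); rewrite scalerA mulVf// scale1r normfV.
by rewrite ler_pdivlMl// normr_gt0.
Qed.

Lemma dual_norm_eq0 (f : dual) : dual_norm f = 0 -> f = 0.
Proof.
move=> f0; apply/val_inj/funext => x /=.
transitivity (0 : R^o); last by [].
have f1 (u : X) : `|u| <= 1 -> f u = 0.
  by move=> /(@dual_norm_ub f); rewrite f0 normr_le0 => /eqP.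
have [->|x0] := eqVneq x 0; first by rewrite f1// normr0.
have := @f1 (`|x|^-1 *: x); rewrite normfZV// lexx linearZ => /(_ isT)/eqP.
by rewrite scaler_eq0 invr_eq0 normr_eq0 (negbTE x0) => /eqP.
Qed.

HB.instance Definition _ :=
  Lmodule_isNormed.Build R dual dual_normD dual_normZ dual_norm_eq0.

(* X^* with the weak* topology, i.e. that of pointwise convergence on X. *)
Definition weak_star : Type :=
  initial_topology (fun f : dual => (dual_fun f : {ptws X -> R^o})).

HB.instance Definition _ := Topological.copy weak_star
  (initial_topology (fun f : dual => (dual_fun f : {ptws X -> R^o}))).

End dual_space.

(* Y x R^m with the norm |y| + sum_i |z_i|; the library's norm on the product
   Y * 'rV[R]_m is the max norm, hence the alias. *)
Section l1prod.
Context {R : realType} (Y : normedModType R) (m : nat).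

Definition l1prod : Type := (Y * 'rV[R]_m)%type.

HB.instance Definition _ := GRing.Lmodule.copy l1prod (Y * 'rV[R]_m)%type.

Definition l1norm (w : l1prod) : R := `|w.1| + \sum_(i < m) `|w.2 ord0 i|.

Lemma l1normD (v w : l1prod) : l1norm (v + w) <= l1norm v + l1norm w.
Proof.
rewrite /l1norm addrACA -big_split/= lerD ?ler_normD// ler_sum// => i _.
by rewrite mxE ler_normD.
Qed.

Lemma l1normZ (a : R) (w : l1prod) : l1norm (a *: w) = `|a| * l1norm w.
Proof.
rewrite /l1norm mulrDr mulr_sumr normrZ; congr (_ + _).
by apply: eq_bigr => i _; rewrite mxE normrM.
Qed.

Lemma l1norm_eq0 (w : l1prod) : l1norm w = 0 -> w = 0.
Proof.
case: w => y z /eqP.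
rewrite paddr_eq0 ?sumr_ge0//= normr_eq0 => /andP[/eqP-> z0].
congr (_, _); apply/rowP => i; rewrite mxE; apply/eqP; rewrite -normr_eq0.
by move: z0; rewrite psumr_eq0// => /allP/(_ i); apply; rewrite mem_index_enum.
Qed.

HB.instance Definition _ :=
  Lmodule_isNormed.Build R l1prod l1normD l1normZ l1norm_eq0.
End l1prod.

Section metric_regularity.
Context {R : realType}.

Definition cball {E : normedModType R} (a : E) (r : R) : set E :=
  [set b | `|b - a| <= r].

Definition unit_sphere (E : normedModType R) : set E := [set e | `|e| = 1].

(* d(a, C), with value +oo when C is empty. *)
Definition set_dist {E : normedModType R} (a : E) (C : set E) : \bar R :=
  ereal_inf [set `|a - c|%:E | c in C].

Context {X Z : normedModType R}.

Definition metric_regularity_const (Phi : X -> set Z) (xb : X) (zb : Z)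
    (K : R) : Prop :=
  0 < K /\ exists2 r : R, 0 < r &
    forall x z, cball xb r x -> cball zb r z ->
      (set_dist x [set u | Phi u z] <= K%:E * set_dist z (Phi x))%E.

Definition metrically_regular (Phi : X -> set Z) (xb : X) (zb : Z) : Prop :=
  exists K, metric_regularity_const Phi xb zb K.

Definition metric_regularity_norm (Phi : X -> set Z) (xb : X) (zb : Z) :
    \bar R :=
  ereal_inf [set K%:E | K in metric_regularity_const Phi xb zb].

End metric_regularity.
Arguments unit_sphere {R} E.

Section quasidifferential.
Context {R : realType} {X : normedModType R}.

Definition diff_quotient {E : normedModType R} (f : X -> E) (x h : X) : R -> E :=
  fun a => a^-1 *: (f (x + a *: h) - f x).

Definition dir_derivable {E : normedModType R} (f : X -> E) (x h : X) : Prop :=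
  cvg (diff_quotient f x h a @[a --> 0^'+]).

Definition dir_derive {E : normedModType R} (f : X -> E) (x h : X) : E :=
  lim (diff_quotient f x h a @[a --> 0^'+]).

Definition is_max (S : set R) (M : R) : Prop := (S `&` ubound S) M.
Definition is_min (S : set R) (M : R) : Prop := (S `&` lbound S) M.

(* A pair [subdifferential, superdifferential]. *)
Definition qdpair : Type := (set (dual X) * set (dual X))%type.

Definition convex_wcompact (A : set (dual X)) : Prop :=
  [/\ A !=set0, convex_set (A : set (convex_lmodType (dual X)))
    & compact (A : set (weak_star X))].

Definition qd_represents (D : qdpair) (phi : X -> R) : Prop :=
  [/\ convex_wcompact D.1, convex_wcompact D.2 &
    forall h, exists M m,
      [/\ is_max [set v h | v in D.1] M, is_min [set w h | w in D.2] m
        & phi h = M + m]].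

Definition is_quasidifferential (f : X -> R) (x : X) (D : qdpair) : Prop :=
  (forall h, dir_derivable (f : X -> R^o) x h) /\
  qd_represents D (dir_derive (f : X -> R^o) x).

Definition is_scalar_quasidifferential {Y : normedModType R} (G : X -> Y)
    (x : X) (D : dual Y -> qdpair) : Prop :=
  (forall h, dir_derivable G x h) /\
  forall ys : dual Y, qd_represents (D ys) (fun h => ys (dir_derive G x h)).

(* Quasidifferential sum [D]^+. *)
Definition qdsum (D : qdpair) : set (dual X) :=
  [set v + w | v in D.1 & w in D.2].

End quasidifferential.
Arguments qdpair {R} X.

Section parametric_system.
Context {R : realType} {X Y : normedModType R} {P : metricType R} {m : nat}.
Variables (F : X * P -> Y) (g : 'I_m -> X * P -> R).

Definition feasible_set (p : P) (y : Y) (z : 'rV[R]_m) : set X :=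
  [set x | F (x, p) = y /\ forall i, g i (x, p) <= z ord0 i].

Definition active (x : X) (p : P) : set 'I_m := [set i | g i (x, p) = 0].

Definition Phi (p : P) (x : X) : set (l1prod Y m) :=
  [set F (x, p)] `*` [set z : 'rV[R]_m | forall i, g i (x, p) <= z ord0 i].

Definition qd_outer_semicontinuous (U : set (X * P)) (D : X -> P -> qdpair X)
    (xb : X) (pb : P) : Prop :=
  forall V1 V2 : set (dual X), open V1 -> open V2 ->
    (D xb pb).1 `<=` V1 -> (D xb pb).2 `<=` V2 ->
    exists2 delta : R, 0 < delta &
      forall x p, U (x, p) -> `|x - xb| < delta -> mdist p pb < delta ->
        (D x p).1 `<=` V1 /\ (D x p).2 `<=` V2.

Definition qdsum_uniformly_osc (D : X -> P -> dual Y -> qdpair X)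
    (xb : X) (pb : P) : Prop :=
  forall eps : R, 0 < eps -> exists2 delta : R, 0 < delta &
    forall (ys : dual Y) x p,
      unit_sphere (dual Y) ys -> cball xb delta x -> mdist p pb <= delta ->
      qdsum (D x p ys) `<=`
        [set v + w | v in qdsum (D xb pb ys) & w in cball 0 eps].

(* The union of the S ys over the norming functionals ys of y. *)
Definition support_union (S : dual Y -> set (dual X)) (y : Y) : set (dual X) :=
  \bigcup_(ys in [set ys | unit_sphere (dual Y) ys /\ ys y = `|y|]) S ys.

(* With the infima in \bar R, the first condition holds vacuously when the unit
   sphere of Y^* is empty (Y = 0), since then the infimum is +oo. *)
Definition qd_MFCQ (DF : X -> P -> dual Y -> qdpair X)
    (Dg : 'I_m -> X -> P -> qdpair X) (xb : X) (pb : P) : Prop :=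
  (0 < ereal_inf [set ereal_inf [set `|v|%:E | v in qdsum (DF xb pb ys)]
                 | ys in unit_sphere (dual Y)])%E /\
  exists h : X,
    (forall (ys : dual Y) (v : dual X), qdsum (DF xb pb ys) v -> v h = 0) /\
    (forall i (v : dual X),
       active xb pb i -> qdsum (Dg i xb pb) v -> v h < 0).

End parametric_system.

(* Main.v *)
From HB Require Import structures.
Require Import Defs.
From mathcomp Require Import all_boot all_order all_algebra.
From mathcomp Require Import all_classical all_reals all_analysis.
From mathcomp Require Import ring lra.

Set Implicit Arguments.
Unset Strict Implicit.
Unset Printing Implicit Defensive.
Import Order.TTheory GRing.Theory Num.Theory.
Import numFieldNormedType.Exports.

Local Open Scope classical_set_scope.
Local Open Scope ring_scope.

(** The system is governed by the residual
      |F(x, p) - y| + sum_i max(g_i(x, p) - z_i, 0),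
    which vanishes exactly on the solution set S(p, y, z).  If the residual has,
    at each nearby point where it is positive, a point x' <> x with
    residual x' + k |x' - x| <= residual x, for one constant k, then a
    Caristi-Ekeland iteration in the complete space X ends at a solution within
    distance residual / k (descent_error_bound).  So everything rests on finding,
    with constants that do not depend on x, p, y, z, directions of decrease.

    Such directions come from the constraint qualification by duality.  For a
    unit vector u of Y, the set D(u) of functionals attached to the norming
    functionals of u is convex, weak-star closed and avoids a fixed ball of
    radius b around the origin; separating it from that ball gives a vector h1
    in the unit ball of X with v h1 <= - b on D(u) (uniform_descent_direction).
    Taking for u the normalised F(x, p) - y, the directional derivative of
    |F(., p) - y| along h1 is attained at a norming functional of u
    (norm_dir_functional), and the attained maximum and minimum in a
    quasidifferential show that it is at most the supremum of D(u) on h1, up to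
    the outer semicontinuity error.  Adding a large multiple hb of the
    Mangasarian-Fromovitz direction leaves this estimate unchanged, since all
    functionals coming from F vanish on hb, and makes the active constraints
    decrease, because their quasidifferential sums are norm bounded by the
    uniform boundedness principle (rescaled_direction).  When F(x, p) = y the
    vector hb alone decreases a violated constraint faster than it can increase
    the first term (descent_direction).

    All the convex duality is drawn from one form of the Hahn-Banach theorem,
    hahn_banach_cone, through a sandwich theorem of Mazur-Orlicz type
    (sandwich). *)

(** * Hahn-Banach and sandwich theorems *)

Section hahn_banach.
Context {R : realType} {V : lmodType R}.

(** A pair (x, r) of the cone stands for the requirement l x <= r on the linear
    functional l to be found. *)
Record dominating_cone (G : set (V * R)) : Prop := DominatingCone {
  coneD : forall x y r s, G (x, r) -> G (y, s) -> G (x + y, r + s);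
  coneZ : forall a x r, 0 < a -> G (x, r) -> G (a *: x, a * r);
  cone_total : forall x, exists r, G (x, r);
  cone_ge0 : forall r, G (0, r) -> 0 <= r }.

(** Every defining condition involves at most two members of the cone, so it
    passes to unions of chains; joining G0 to each union takes care of the empty
    chain, whose union is not total. *)
Lemma maximal_dominating_cone (G0 : set (V * R)) : dominating_cone G0 ->
  exists2 G, dominating_cone G & G0 `<=` G /\
    forall G', dominating_cone G' -> G `<=` G' -> G' `<=` G.
Proof.
move=> cG0.
pose P (A : set (V * R)) := dominating_cone (A `|` G0).
have [|A [PA Amax]] := @Zorn_bigcup _ P; last first.
  exists (A `|` G0) => //; split=> [z|G' cG' AG' z G'z]; first by right.
  apply: contrapT => nAz; apply: (Amax G').
    split=> [w Aw|/(_ z G'z) Az]; first by apply: AG'; left.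
    by apply: nAz; left.
  rewrite /P (_ : G' `|` G0 = G')//; apply/setUidPl => w G0w.
  by apply: AG'; right.
move=> C CP Ctot; rewrite /P.
have two z w : (\bigcup_(X in C) X `|` G0) z -> (\bigcup_(X in C) X `|` G0) w ->
    exists2 B, dominating_cone B & B `<=` \bigcup_(X in C) X `|` G0 /\ B z /\ B w.
  have sub A : C A -> A `|` G0 `<=` \bigcup_(X in C) X `|` G0.
    by move=> CA u [Au|]; [left; exists A|right].
  move=> [[A CA Az]|G0z] [[B CB Bw]|G0w].
  - have [AB|BA] := Ctot A B CA CB.
      exists (B `|` G0); first exact: CP.
      by split; [exact: sub|split; left => //; exact: AB].
    exists (A `|` G0); first exact: CP.
    by split; [exact: sub|split; left => //; exact: BA].
  - exists (A `|` G0); first exact: CP.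
    by split; [exact: sub|split; [left|right]].
  - exists (B `|` G0); first exact: CP.
    by split; [exact: sub|split; [right|left]].
  - by exists G0 => //; split => // u; right.
split.
- move=> x y r s Gx Gy; have [B cB [Bs [Bx By]]] := two _ _ Gx Gy.
  by apply: Bs; exact: coneD.
- move=> a x r a0 Gx; have [B cB [Bs [Bx _]]] := two _ _ Gx Gx.
  by apply: Bs; exact: coneZ.
- by move=> x; have [r G0r] := cone_total cG0 x; exists r; right.
- move=> r Gr; have [B cB [_ [Br _]]] := two _ _ Gr Gr.
  exact: cone_ge0 cB _ Br.
Qed.

Lemma cone_zero (G : set (V * R)) : dominating_cone G ->
  (forall G', dominating_cone G' -> G `<=` G' -> G' `<=` G) -> G (0, 0).
Proof.
move=> cG Gmax; pose G' := G `|` [set (0, 0)].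
have G'c : dominating_cone G'.
  split.
  - move=> x y r s [Gx|[-> ->]] [Gy|[-> ->]]; rewrite ?add0r ?addr0.
    + by left; exact: coneD.
    + by left.
    + by left.
    + by right.
  - move=> a x r a0 [Gx|[-> ->]]; first by left; exact: coneZ.
    by right; rewrite scaler0 mulr0.
  - by move=> x; have [r Gr] := cone_total cG x; exists r; left.
  - by move=> r [/(cone_ge0 cG)//|[->]].
by apply: (Gmax G') => //; [move=> z; left|right].
Qed.

(** If c is the infimum of the r with (d, r) in G, then adjoining the ray of
    (- d, - c) to G creates no new negative value above the origin; maximality
    therefore puts (- d, - c) in G.  The same for - d closes the line. *)
Lemma maximal_cone_line (G : set (V * R)) : dominating_cone G ->
    (forall G', dominating_cone G' -> G `<=` G' -> G' `<=` G) ->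
  forall d, exists c, G (d, c) /\ G (- d, - c).
Proof.
move=> cG Gmax d; have G00 := cone_zero cG Gmax.
have G0Z a x r : 0 <= a -> G (x, r) -> G (a *: x, a * r).
  rewrite le_eqVlt => /predU1P[<- _|a0 Gx]; first by rewrite scale0r mul0r.
  exact: coneZ.
have lower e : exists b, forall r, G (e, r) -> b <= r.
  have [s Gs] := cone_total cG (- e); exists (- s) => r Gr.
  have := coneD cG Gr Gs; rewrite subrr => /(cone_ge0 cG); lra.
pose c e := inf [set r | G (e, r)].
have c_lb e r : G (e, r) -> c e <= r.
  move=> Gr; apply: ge_inf => //; have [b bP] := lower e.
  by exists b => s /= /bP.
have add e : G (- e, - c e).
  pose G' := [set z : V * R | exists x r t, [/\ G (x, r), 0 <= t &
                z = (x - t *: e, r - t * c e)]].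
  apply: (Gmax G'); last first.
  - by exists 0, 0, 1; rewrite scale1r mul1r !sub0r.
  - by move=> [x r] Gx; exists x, r, 0; rewrite scale0r mul0r !subr0.
  split.
  - move=> _ _ _ _ [x [r [t [Gx t0 [-> ->]]]]] [y [s [u [Gy u0 [-> ->]]]]].
    exists (x + y), (r + s), (t + u); split; [exact: coneD|exact: addr_ge0|].
    by congr (_, _); [rewrite scalerDl opprD addrACA|lra].
  - move=> a _ _ a0 [x [r [t [Gx t0 [-> ->]]]]].
    exists (a *: x), (a * r), (a * t); split; [exact: coneZ| |].
      by rewrite mulr_ge0// ltW.
    by congr (_, _); [rewrite scalerBr scalerA|rewrite mulrBr mulrA].
  - move=> x; have [r Gr] := cone_total cG x; exists r.
    by exists x, r, 0; rewrite scale0r mul0r !subr0.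
  - move=> _ [x [r [t [Gx t0 [/esym/eqP + ->]]]]]; rewrite subr_eq0 => /eqP xE.
    move: t0 Gx; rewrite le_eqVlt xE => /predU1P[<-|t0 Gx].
      by rewrite scale0r mul0r subr0 => /(cone_ge0 cG).
    rewrite subr_ge0 mulrC -ler_pdivlMr//; apply: c_lb.
    have := coneZ cG (_ : 0 < t^-1) Gx.
    by rewrite scalerA mulVf ?gt_eqF// scale1r mulrC; apply; rewrite invr_gt0.
have c_glb e b : (forall r, G (e, r) -> b <= r) -> b <= c e.
  move=> bP; apply: lb_le_inf => //.
  by have [r Gr] := cone_total cG e; exists r.
exists (c d); split => //.
have dN : G (d, - c (- d)) by have := add (- d); rewrite opprK.
suff -> : c d = - c (- d) by [].
apply/eqP; rewrite eq_le c_lb//=; apply: (c_glb d) => r Gr.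
rewrite lerNl; apply: c_glb => s Gs.
have := coneD cG Gr Gs; rewrite subrr => /(cone_ge0 cG); lra.
Qed.

(** Hahn-Banach: the lines contained in a maximal cone form the graph of a linear
    functional, and every other requirement of the cone follows from them. *)
Theorem hahn_banach_cone (G : set (V * R)) : dominating_cone G ->
  exists2 l : V -> R^o, linear l & forall x r, G (x, r) -> l x <= r.
Proof.
move=> /maximal_dominating_cone[M cM [GM Mmax]].
have /choice[l lP] := maximal_cone_line cM Mmax.
have l_le x r : M (x, r) -> l x <= r.
  move=> Mx; have := coneD cM Mx (proj2 (lP x)).
  by rewrite subrr => /(cone_ge0 cM); rewrite subr_ge0.
have l_eq x c : M (x, c) -> M (- x, - c) -> l x = c.
  move=> Mx MNx; apply/eqP; rewrite eq_le l_le//=.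
  have := coneD cM (proj1 (lP x)) MNx.
  by rewrite subrr => /(cone_ge0 cM); rewrite subr_ge0.
have lN x : l (- x) = - l x by apply: l_eq; rewrite ?opprK; case: (lP x).
have lZ a x : 0 < a -> l (a *: x) = a * l x.
  move=> a0; apply: l_eq; first by apply: coneZ => //; case: (lP x).
  by rewrite -scalerN -mulrN; apply: coneZ => //; case: (lP x).
exists l => [a x y|x r /GM]; last exact: l_le.
have -> : l (a *: x + y) = l (a *: x) + l y.
  apply: l_eq; first by apply: coneD => //; [case: (lP (a *: x))|case: (lP y)].
  by rewrite !opprD; apply: coneD => //; [case: (lP (a *: x))|case: (lP y)].
congr (_ + _); have [a0|a0|->] := ltgtP a 0.
- by rewrite -[a]opprK scaleNr lN lZ ?oppr_gt0// scaleNr.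
- exact: lZ.
- rewrite !scale0r; apply: l_eq; rewrite ?oppr0; exact: (cone_zero cM Mmax).
Qed.
End hahn_banach.

(** Mazur-Orlicz: a sublinear p that dominates the requirements r <= l x listed in
    a convex cone C dominates a linear functional satisfying them.  The conditions
    l x <= p x and r <= l x together generate the cone of all (u, r) with
    p (u + x) - s <= r for some (x, s) in C. *)
Lemma sandwich (R : realType) (V : lmodType R) (p : V -> R) (C : set (V * R)) :
  (forall x y, p (x + y) <= p x + p y) ->
  (forall a x, 0 < a -> p (a *: x) = a * p x) ->
  C (0, 0) ->
  (forall x y r s, C (x, r) -> C (y, s) -> C (x + y, r + s)) ->
  (forall a x r, 0 < a -> C (x, r) -> C (a *: x, a * r)) ->
  (forall x r, C (x, r) -> r <= p x) ->
  exists l : V -> R^o, [/\ linear l, forall x, l x <= p x &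
    forall x r, C (x, r) -> r <= l x].
Proof.
move=> pD pZ C0 CD CZ Cp.
have p0 : p 0 = 0 by have := pZ 2 0 (ltr0n _ 2); rewrite scaler0; lra.
pose G := [set z : V * R | exists x s, C (x, s) /\ p (z.1 + x) - s <= z.2].
have [|l lin lG] := @hahn_banach_cone R V G.
  split.
  - move=> x y r s [x' [r' [Cx' /= xr]]] [y' [s' [Cy' /= ys]]].
    exists (x' + y'), (r' + s'); split; first exact: CD.
    by rewrite /= addrACA; have := pD (x + x') (y + y'); lra.
  - move=> a x r a0 [x' [r' [Cx' /= xr]]].
    exists (a *: x'), (a * r'); split; first exact: CZ.
    by rewrite /= -scalerDr pZ// -mulrBr ler_pM2l.
  - by move=> x; exists (p x), 0, 0; rewrite /= addr0 subr0.
  - by move=> r [x [s [/Cp sp /=]]]; rewrite add0r; lra.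
exists l; split => // [x|x r Cx].
  by apply: lG; exists 0, 0; rewrite /= addr0 subr0.
pose L : {linear V -> R^o} := HB.pack l (GRing.isLinear.Build _ _ _ _ l lin).
have lN : l (- x) = - l x by exact: (linearN L).
rewrite -lerN2 -lN; apply: lG; exists x, r.
by rewrite /= addNr p0 sub0r.
Qed.

Section dual_facts.
Context {R : realType} {X : normedModType R}.
Implicit Types (v : dual X) (x : X).

Lemma dual_le_norm v x : `|v x| <= `|v| * `|x|.
Proof.
have [->|x0] := eqVneq x 0; first by rewrite linear0 !normr0 mulr0.
have x_gt0 : 0 < `|x| by rewrite normr_gt0.
rewrite -ler_pdivrMr// mulrC -[X in X * _]ger0_norm ?invr_ge0// -normrM.
rewrite (_ : _ * _ = v (`|x|^-1 *: x)); last by rewrite linearZ.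
by apply: dual_norm_ub; rewrite normfZV.
Qed.

Lemma dual_of_bounded_linear (l : X -> R^o) (c : R) :
  0 <= c -> linear l -> (forall x, l x <= c * `|x|) ->
  exists2 v : dual X, (forall x, v x = l x) & `|v| <= c.
Proof.
move=> c0 lin lc.
pose L : {linear X -> R^o} := HB.pack l (GRing.isLinear.Build _ _ _ _ l lin).
have lN x : l (- x) = - l x by exact: (linearN L).
have lnorm x : `|l x| <= c * `|x|.
  by rewrite ler_norml lc andbT lerNl -lN -[in leRHS](normrN x) lc.
have lcont : continuous l.
  apply: (@bounded_linear_continuous _ _ _ L).
  apply/linear_boundedP; exists c; split; first exact: num_real.
  by move=> r cr x; rewrite (le_trans (lnorm x))// ler_wpM2r// ltW.
have lP : l \in dual_pred (X := X) by apply/dual_predP.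
exists (Dual lP) => //; apply: dual_norm_le => x x1 /=.
apply: le_trans (lnorm x) _.
by rewrite -[leRHS]mulr1 ler_wpM2l.
Qed.

End dual_facts.

(** * Directional derivatives of the norm *)

Section norm_directional.
Context {R : realType} {Y : normedModType R}.

(** The difference quotients of the norm at u along d decrease to their infimum c.
    The cone spanned by (u, |u|) and (d, c) lies below the norm by the very choice
    of c, so the sandwich theorem yields a subgradient of the norm at u that attains
    the directional derivative c. *)
Lemma norm_dir_functional (u d : Y) : exists ys : dual Y,
  [/\ `|ys| <= 1, ys u = `|u| &
    forall e, 0 < e -> \forall a \near 0^'+,
      `|u + a *: d| <= `|u| + a * (ys d + e)].
Proof.
pose Q := [set (`|u + a *: d| - `|u|) / a | a in [set a : R | 0 < a]].
pose c := inf Q.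
have Qlb : has_lbound Q.
  exists (- `|d|) => _ [a /= a0 <-]; rewrite ler_pdivlMr//.
  have := ler_normB (u + a *: d) (a *: d); rewrite addrK normrZ gtr0_norm//; lra.
have Q0 : Q !=set0 by eexists; exists 1 => //=; exact: ltr01.
have c_le a : 0 <= a -> a * c <= `|u + a *: d| - `|u|.
  rewrite le_eqVlt => /predU1P[<-|a0]; first by rewrite mul0r scale0r addr0 subrr.
  by rewrite mulrC -ler_pdivlMr//; apply: ge_inf => //; exists a.
pose C := [set z : Y * R | exists s t,
  [/\ 0 <= s, 0 <= t & z = (s *: u + t *: d, s * `|u| + t * c)]].
have [||||||l [lin l1 Cl]] := @sandwich R Y (fun x => 1 * `|x|) C.
- by move=> x y; rewrite !mul1r ler_normD.
- by move=> a x a0; rewrite !mul1r normrZ gtr0_norm.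
- by exists 0, 0; rewrite !scale0r !mul0r !addr0.
- move=> _ _ _ _ [s [t [s0 t0 [-> ->]]]] [s' [t' [s'0 t'0 [-> ->]]]].
  exists (s + s'), (t + t'); split; [exact: addr_ge0|exact: addr_ge0|].
  by congr (_, _); [rewrite !scalerDl addrACA|lra].
- move=> a _ _ a0 [s [t [s0 t0 [-> ->]]]].
  exists (a * s), (a * t); split; [by rewrite mulr_ge0// ltW..|].
  by congr (_, _); [rewrite scalerDr !scalerA|rewrite mulrDr !mulrA].
- move=> _ _ [s [t [+ t0 [-> ->]]]]; rewrite mul1r le_eqVlt => /predU1P[<-|s0].
    rewrite scale0r mul0r !add0r normrZ ger0_norm// ler_wpM2l//.
    have := c_le 1 ler01; rewrite mul1r scale1r => /le_trans; apply.
    by rewrite lerBlDl ler_normD.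
  have ts0 : 0 <= t / s by rewrite divr_ge0// ltW.
  have -> : s *: u + t *: d = s *: (u + (t / s) *: d).
    by rewrite scalerDr scalerA mulrCA divff ?gt_eqF// mulr1.
  rewrite normrZ gtr0_norm//.
  have -> : s * `|u| + t * c = s * (`|u| + t / s * c).
    by rewrite mulrDr; congr (_ + _); field; rewrite gt_eqF.
  by rewrite ler_pM2l//; have := c_le _ ts0; lra.
have [ys ysE ys1] := dual_of_bounded_linear ler01 lin l1.
have ysu : ys u = `|u|.
  apply/eqP; rewrite eq_le; apply/andP; split.
    by have := l1 u; rewrite mul1r ysE.
  by rewrite ysE; apply: Cl; exists 1, 0; rewrite scale0r mul0r scale1r mul1r !addr0.
have ysd : c <= ys d.
  by rewrite ysE; apply: Cl; exists 0, 1; rewrite scale0r mul0r scale1r mul1r !add0r.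
exists ys; split => // e e0.
have [_ [b /= b0 <-]] := inf_adherent e0 (conj Q0 Qlb).
rewrite ltr_pdivrMr// => bP.
near=> a.
have a0 : 0 < a by near: a; exact: nbhs_right_gt.
have ab : a <= b by near: a; exact: nbhs_right_le.
(* By convexity the quotient at a is at most the quotient at b. *)
have -> : u + a *: d = (1 - a / b) *: u + (a / b) *: (u + b *: d).
  by rewrite scalerDr scalerA divfK ?gt_eqF// addrA -scalerDl subrK scale1r.
rewrite (le_trans (ler_normD _ _))// (normrZ (1 - a / b)) (normrZ (a / b)).
have ab0 : 0 <= a / b by rewrite divr_ge0// ltW.
have ab1 : 0 <= 1 - a / b by rewrite subr_ge0 ler_pdivrMr// mul1r.
rewrite (ger0_norm ab0) (ger0_norm ab1).
have : a / b * `|u + b *: d| <= a / b * (`|u| + (c + e) * b).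
  by rewrite ler_wpM2l //; move: bP; rewrite -/c; lra.
have -> : a / b * (`|u| + (c + e) * b) = a / b * `|u| + a * (c + e).
  by field; rewrite gt_eqF.
have : a * (c + e) <= a * (ys d + e) by rewrite ler_pM2l// lerD2r.
lra.
Unshelve. all: by end_near. Qed.
End norm_directional.

(** * Separation in the weak-star topology *)

Section weak_star_separation.
Context {R : realType} {X : normedModType R}.
Implicit Types (D : set (dual X)) (f v : dual X).

(** Otherwise the sets of members of D close to f on a finite set of vectors
    generate a filter on D that converges to f pointwise, hence weak-star. *)
Lemma weak_star_closed_coordinates D f : closed (D : set (weak_star X)) -> ~ D f ->
  exists (n : nat) (s : 'I_n -> X) (e : R),
    0 < e /\ forall v, D v -> e <= \sum_(k < n) `|v (s k) - f (s k)|.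
Proof.
move=> cD nDf; apply: contrapT => nsep; apply: nDf.
pose B (z : seq X * R) := [set v | D v /\ forall x, x \in z.1 -> `|v x - f x| < z.2].
pose dom := [set z : seq X * R | 0 < z.2].
have Bne z : dom z -> B z !=set0.
  case: z => s e /= e0; apply: contrapT => Bs; apply: nsep.
  exists (size s), (fun k => nth 0 s k), e; split => // v Dv.
  rewrite leNgt; apply/negP => small; apply: Bs; exists v; split => // x xs.
  rewrite (le_lt_trans _ small)// -(nth_index 0 xs).
  have ks : (index x s < size s)%N by rewrite index_mem.
  by rewrite (bigD1 (Ordinal ks))//= lerDl sumr_ge0.
pose F := filter_from dom B.
have FF : ProperFilter F.
  apply: filter_from_proper => //; apply: filter_from_filter.
    by exists ([::], 1); rewrite /dom /= ltr01.
  move=> [s e] [t d] /= e0 d0; exists (s ++ t, Num.min e d).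
    by rewrite /dom /= lt_min e0.
  move=> v [Dv vst]; split; split=> //= x xin.
    by have := vst x; rewrite /= mem_cat xin => /(_ isT); rewrite lt_min => /andP[].
  by have := vst x; rewrite /= mem_cat xin orbT => /(_ isT); rewrite lt_min => /andP[].
have Ff : F --> (f : weak_star X).
  have cvgf : {ptws, (fun v : dual X => (dual_fun v : X -> R^o)) @ F -->
      (dual_fun f : X -> R^o)}.
    apply/pointwise_cvgP => x; apply/cvgrPdist_lt => e e0.
    exists ([:: x], e) => //= v [_ /(_ x)]; rewrite inE eqxx => /(_ isT) /=.
    by rewrite distrC.
  move=> A [_ [[C oC <-] Cf] CA].
  apply: filterS CA _; apply: cvgf.
  by apply: open_nbhs_nbhs; split.
apply: (cD f) => A /Ff FA.
have FD : F D by exists ([::], 1) => [|v []]; rewrite /dom //= ltr01.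
exact: (@filter_ex _ F _ _ (filterI FD FA)).
Qed.

Lemma dual_combE (a b : R) v w (x : X) :
  (a *: v + b *: w) x = a * v x + b * w x.
Proof. by []. Qed.

Lemma convex_comb D (a b : R) v w :
  convex_set (D : set (convex_lmodType (dual X))) ->
  D v -> D w -> 0 <= a -> 0 <= b -> a + b = 1 -> D (a *: v + b *: w).
Proof.
move=> cD Dv Dw a0 b0 ab.
have a1 : a <= 1 by rewrite -ab lerDl.
have := cD v w (Itv01 a0 a1); rewrite !inE => /(_ Dv Dw).
have -> : b = 1 - a by lra.
exact.
Qed.

(** Finitely many coordinates already keep D away from f, so the separation takes
    place in a finite-dimensional space, where each linear functional is evaluation
    at a combination of the chosen vectors. *)
Lemma weak_star_separation D f : D !=set0 ->
  closed (D : set (weak_star X)) ->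
  convex_set (D : set (convex_lmodType (dual X))) -> ~ D f ->
  exists (h : X) (e : R), 0 < e /\ forall v, D v -> f h + e <= v h.
Proof.
move=> [v0 Dv0] cD xD nDf.
have [n [s [e [e0 De]]]] := weak_star_closed_coordinates cD nDf.
pose T v : 'rV[R]_n := \row_k (v (s k) - f (s k)).
pose C := [set z : 'rV[R]_n * R | exists v t,
  [/\ D v, 0 <= t & z = (t *: T v, t * e)]].
have [||||||l [lin _ Cl]] :=
  @sandwich R 'rV[R]_n (fun u => \sum_(k < n) `|u ord0 k|) C.
- move=> x y; rewrite -big_split /=; apply: ler_sum => k _.
  by rewrite mxE ler_normD.
- move=> a x a0; rewrite mulr_sumr; apply: eq_bigr => k _.
  by rewrite mxE normrM gtr0_norm.
- by exists v0, 0; rewrite scale0r mul0r.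
- move=> _ _ _ _ [v [t [Dv t0 [-> ->]]]] [w [r [Dw r0 [-> ->]]]].
  have [tr0|tr0] := eqVneq (t + r) 0.
    have [-> ->] : t = 0 /\ r = 0 by lra.
    by exists v0, 0; rewrite !scale0r !mul0r !addr0.
  have tr : 0 < t + r by rewrite lt_neqAle eq_sym tr0 addr_ge0.
  exists ((t / (t + r)) *: v + (r / (t + r)) *: w), (t + r); split.
  + apply: convex_comb => //; [exact: divr_ge0 (ltW _)..|].
    by rewrite -mulrDl divff.
  + exact: ltW.
  + congr (_, _); last by rewrite mulrDl.
    apply/rowP => k; rewrite !mxE.
    rewrite dual_combE.
    by field.
- move=> a _ _ a0 [v [t [Dv t0 [-> ->]]]].
  by exists v, (a * t); split; rewrite ?scalerA ?mulrA// mulr_ge0// ltW.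
- move=> _ _ [v [t [Dv t0 [-> ->]]]].
  under eq_bigr do rewrite !mxE normrM ger0_norm//.
  by rewrite -mulr_sumr ler_wpM2l// De.
pose L : {linear 'rV[R]_n -> R^o} := HB.pack l (GRing.isLinear.Build _ _ _ _ l lin).
pose c k := l (delta_mx ord0 k).
exists (\sum_k c k *: s k), e; split => // v Dv.
have : e <= l (T v) by apply: Cl; exists v, 1; rewrite scale1r mul1r.
suff -> : l (T v) = v (\sum_k c k *: s k) - f (\sum_k c k *: s k) by lra.
rewrite (row_sum_delta (T v)) -[l]/(L : _ -> _) linear_sum.
rewrite (linear_sum v) (linear_sum f) -sumrB.
apply: eq_bigr => k _; rewrite linearZ (linearZ_LR v) (linearZ_LR f) /= mxE.
by rewrite -scalerBr /c [LHS]mulrC.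
Qed.

(** This separates D from the closed ball of radius b.  If no h worked, then
    r <= v x on D would imply r <= b |x|; the sandwich theorem would give f in the
    ball such that f x is at least the infimum of D on x, for every x, and
    weak_star_separation would put f in D. *)
Lemma uniform_descent_direction D (b : R) : 0 <= b ->
  closed (D : set (weak_star X)) ->
  convex_set (D : set (convex_lmodType (dual X))) ->
  (forall v, D v -> b < `|v|) ->
  exists2 h : X, `|h| <= 1 & forall v, D v -> v h <= - b.
Proof.
move=> b0 cD xD Db.
have [[v0 Dv0]|D0] := pselect (D !=set0); last first.
  by exists 0 => [|v Dv]; [rewrite normr0|case: D0; exists v].
apply: contrapT => noh.
have Dsup x r : (forall v, D v -> r <= v x) -> r <= b * `|x|.
  move=> rD; rewrite leNgt; apply/negP => br; apply: noh.
  have [x0|x0] := eqVneq x 0.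
    by move: br (rD _ Dv0); rewrite x0 normr0 mulr0 linear0; lra.
  have xp : 0 < `|x| by rewrite normr_gt0.
  exists (- (`|x|^-1 *: x)) => [|v Dv]; first by rewrite normrN normfZV.
  rewrite linearN linearZ /= lerN2 -[_ *: _]/(_ * _) mulrC ler_pdivlMr//.
  exact: le_trans (ltW br) (rD _ Dv).
pose C := [set z : X * R | forall v, D v -> z.2 <= v z.1].
have [||||||l [lin lb Cl]] := @sandwich R X (fun x => b * `|x|) C.
- by move=> x y; rewrite -mulrDr ler_wpM2l// ler_normD.
- by move=> a x a0; rewrite normrZ gtr0_norm// mulrCA.
- by move=> v Dv /=; rewrite linear0.
- by move=> x y r s Cx Cy v Dv /=; rewrite linearD lerD//; [exact: Cx|exact: Cy].
- by move=> a x r a0 Cx v Dv /=; rewrite linearZ ler_pM2l//; exact: Cx.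
- by move=> x r Cx; apply: Dsup.
have [f fl fb] := dual_of_bounded_linear b0 lin lb.
have nDf : ~ D f by move=> /Db; rewrite ltNge fb.
have [h [e [e0 he]]] := weak_star_separation (ex_intro _ _ Dv0) cD xD nDf.
have := Cl h (f h + e) he; rewrite fl; lra.
Qed.
End weak_star_separation.

(** * Quasidifferential sums *)

Section quasidifferential_sums.
Context {R : realType} {X : normedModType R}.
Implicit Types (D : qdpair X) (phi : X -> R).

(** The maximum and the minimum being attained, phi h is the value at h of a
    single member of the sum. *)
Lemma qd_represents_le D phi (h : X) (c : R) : qd_represents D phi ->
  (forall v, qdsum D v -> v h <= c) -> phi h <= c.
Proof.
move=> [_ _ Dphi] Dc; have [M [m [[[v Dv <-] _] [[w Dw <-] _] ->]]] := Dphi h.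
by apply: (Dc (v + w)); exists v => //; exists w.
Qed.

(** The supremum over the sum is attained: by a maximiser of D.1 at h and a
    minimiser of D.2 at - h. *)
Lemma qdsum_lt0 D phi (h : X) : qd_represents D phi ->
  (forall v, qdsum D v -> v h < 0) ->
  exists2 e : R, 0 < e & forall v, qdsum D v -> v h <= - e.
Proof.
move=> [_ _ Dphi] D0.
have [M [_ [[[v Dv <-] vmax] _ _]]] := Dphi h.
have [_ [m [_ [[w Dw <-] wmin] _]]] := Dphi (- h).
exists (- (v + w) h) => [|_ [v' Dv' [w' Dw' <-]]].
  by rewrite oppr_gt0; apply: D0; exists v => //; exists w.
rewrite opprK; apply: (@lerD R).
  by apply: vmax; exists v'.
rewrite -lerN2 -!linearN; apply: wmin; by exists w'.
Qed.

Lemma qdsum_pointwise_bounded D phi (h : X) : qd_represents D phi ->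
  exists C : R, forall v, qdsum D v -> `|v h| <= C.
Proof.
have upper k : qd_represents D phi -> exists C : R, forall v, qdsum D v -> v k <= C.
  move=> [_ _ Dphi].
  have [M [_ [[_ vmax] _ _]]] := Dphi k.
  have [_ [m [_ [_ wmin] _]]] := Dphi (- k).
  exists (M - m) => _ [v Dv [w Dw <-]]; apply: (@lerD R).
    by apply: vmax; exists v.
  by rewrite lerNr -linearN; apply: wmin; exists w.
move=> DP; have [a aP] := upper h DP; have [b bP] := upper (- h) DP.
exists (Num.max a b) => v Dv; rewrite ler_norml lerNl -linearN !le_max.
by rewrite aP// bP// orbT.
Qed.
End quasidifferential_sums.

(** Pointwise bounds come from the maxima and minima at h and - h; completeness of X
    turns them into a norm bound. *)
Lemma qdsum_bounded (R : realType) (X : completeNormedModType R) (D : qdpair X)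
    (phi : X -> R) : qd_represents D phi ->
  exists2 C : R, 0 <= C & forall v, qdsum D v -> `|v| <= C.
Proof.
move=> DP; pose A := [set (dual_fun v : X -> R^o) | v in qdsum D].
have [|x|M MP] := @Banach_Steinhauss R X R^o A _ _ 1.
- move=> _ [v _ <-]; split; last exact: dual_linear.
  move=> r; exists (`|v| * r) => x xr.
  by rewrite (le_trans (dual_le_norm v x))// ler_wpM2l.
- have [C CP] := qdsum_pointwise_bounded x DP.
  by exists C => _ [v Dv <-]; exact: CP.
exists (Num.max 0 M); first by rewrite le_max lexx.
move=> v Dv; rewrite le_max; apply/orP; right.
by apply: dual_norm_le => x x1; apply: MP => //; exists v.
Qed.

(** Caristi-Ekeland iteration.  Move from x to a point of
    T x = [u | phi u + k |u - x| <= phi x] that gets at least half-way to the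
    infimum of phi on T x.  The total length of the moves is at most phi x0 / k, so
    they converge, to a point whose T is reduced to itself; a positive value of phi
    there would contradict the descent condition. *)
Lemma descent_error_bound (R : realType) (X : completeNormedModType R)
    (phi : X -> R) (x0 : X) (k rho : R) :
  continuous phi -> (forall x, 0 <= phi x) -> 0 < k -> phi x0 < k * rho ->
  (forall x, `|x - x0| < rho -> 0 < phi x ->
     exists2 x', x' != x & phi x' + k * `|x' - x| <= phi x) ->
  exists2 x, phi x = 0 & k * `|x - x0| <= phi x0.
Proof.
move=> cphi phi0 k0 phix0 descent.
pose T x := [set u | phi u + k * `|u - x| <= phi x].
have Txx x : T x x by rewrite /T /= subrr normr0 mulr0 addr0.
have Ttrans x y z : T x y -> T y z -> T x z.
  rewrite /T /= => xy yz.
  have : k * `|z - x| <= k * (`|z - y| + `|y - x|).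
    by rewrite ler_wpM2l ?ler_distD// ltW.
  lra.
have /choice[f fP] x : exists u, T x u /\
    forall w, T x w -> phi u <= (phi x + phi w) / 2.
  pose m := inf (phi @` T x).
  have Tinf : has_inf (phi @` T x).
    by split; [exists (phi x), x|exists 0 => _ [w _ <-]].
  have m_le w : T x w -> m <= phi w.
    by move=> Tw; apply: ge_inf; [case: Tinf|exists w].
  have [mx|xm] := ltP m (phi x); last first.
    by exists x; split => // w /m_le; lra.
  have [|_ [u Tu <-] um] := @inf_adherent _ (phi @` T x) ((phi x - m) / 2) _ Tinf.
    by rewrite divr_gt0 ?subr_gt0.
  by exists u; split => // w /m_le; move: um; rewrite -/m; lra.
pose u n := iter n f x0.
have uT n p : (n <= p)%N -> T (u n) (u p).
  move=> /subnK <-; elim: (p - n)%N => [|q IH]; first exact: Txx.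
  by apply: Ttrans IH _; rewrite addSn; exact: (fP _).1.
pose L := inf (range (phi \o u)).
have uinf : has_inf (range (phi \o u)).
  by split; [exists (phi (u 0%N)), 0%N|exists 0 => _ [n _ <-]; exact: phi0].
have L_le n : L <= phi (u n) by apply: ge_inf; [case: uinf|exists n].
have ucvg : cvg (u @ \oo).
  apply/cauchy_cvgP/cauchy_exP => e e0.
  have [|_ [n _ <-] uL] := @inf_adherent _ (range (phi \o u)) (k * e) _ uinf.
    exact: mulr_gt0.
  exists (u n); exists n => // p /= /uT; rewrite /T /= => uTp.
  rewrite -ball_normE /= -(ltr_pM2l k0) distrC.
  by have := L_le p; move: uL; rewrite -/L /=; lra.
pose xs : X := lim (u @ \oo).
have xsT n : T (u n) xs.
  apply: (@closed_cvg _ _ _ _ (fun p => u p) (T (u n))) ucvg => //.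
    rewrite (_ : T _ =
      (fun w => phi w + k * `|w - u n|) @^-1` [set r | r <= phi (u n)])//.
    apply: preimage_closed; last exact: closed_le.
    move=> w _; apply: cvgD; first exact: cphi.
    apply: cvgM; first exact: cvg_cst.
    by apply: cvg_norm; apply: cvgB; [exact: cvg_id|exact: cvg_cst].
  by exists n => // p /uT.
have xsL : phi xs <= L.
  apply: lb_le_inf; first by case: uinf.
  move=> _ [n _ <-] /=; apply: le_trans (xsT n).
  by rewrite lerDl mulr_ge0// ltW.
have xsx0 : k * `|xs - x0| <= phi x0.
  by have := xsT 0%N; rewrite /T /=; have := phi0 xs; lra.
exists xs => //; apply/eqP; rewrite eq_le phi0 andbT leNgt; apply/negP => xs_gt0.
have [|x' x'xs Tx'] := descent xs _ xs_gt0.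
  by rewrite -(ltr_pM2l k0) (le_lt_trans xsx0).
(* x' belongs to every T (u n), and phi (u n.+1) is at most half-way between
   phi (u n) and phi x': in the limit L <= phi x', whereas phi x' < phi xs. *)
have : phi x' < phi xs.
  have : 0 < k * `|x' - xs| by rewrite mulr_gt0// normr_gt0 subr_eq0.
  lra.
rewrite ltNge => /negP; apply; apply: le_trans xsL _.
suff : 2 * L - phi x' <= L by lra.
apply: lb_le_inf; first by case: uinf.
move=> _ [n _ <-] /=; have := (fP (u n)).2 x' (Ttrans _ _ _ (xsT n) Tx').
have := L_le n.+1; rewrite /u /=; lra.
Qed.

(** * One-sided directional estimates *)

Section directional_estimates.
Context {R : realType} {X : normedModType R}.

Lemma diff_quotientE (E : normedModType R) (G : X -> E) (x h : X) (a : R) :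
  a != 0 -> G (x + a *: h) = G x + a *: diff_quotient G x h a.
Proof. by move=> a0; rewrite /diff_quotient scalerA divff// scale1r subrKC. Qed.

Lemma dir_derive_upper (f : X -> R) (x h : X) (c : R) :
  dir_derivable (f : X -> R^o) x h -> dir_derive (f : X -> R^o) x h < c ->
  \forall a \near 0^'+, f (x + a *: h) <= f x + a * c.
Proof.
move=> df fc; near=> a.
have a0 : 0 < a by near: a; exact: nbhs_right_gt.
rewrite (@diff_quotientE R^o f)// ?gt_eqF// lerD2l.
rewrite [_ *: _]/(a * _) ler_pM2l//.
by near: a; exact: (cvgr_le _ df).
Unshelve. all: by end_near. Qed.

(** The functional attaining the directional derivative of the norm has norm 1
    when G x - y is nonzero; when G x = y it may be shorter, and is compared with
    its normalisation, which requires b to be nonnegative. *)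
Lemma dir_derive_norm_upper (Y : normedModType R) (G : X -> Y) (x h : X) (y : Y)
    (b c : R) :
  dir_derivable G x h -> b < c -> 0 <= b \/ G x != y ->
  (forall ys : dual Y, unit_sphere (dual Y) ys -> ys (G x - y) = `|G x - y| ->
     ys (dir_derive G x h) <= b) ->
  \forall a \near 0^'+, `|G (x + a *: h) - y| <= `|G x - y| + a * c.
Proof.
move=> dG bc bG normb.
have [ys [ys1 ysu ysd]] := norm_dir_functional (G x - y) (dir_derive G x h).
have ysb : ys (dir_derive G x h) <= b.
  have [/normb//|ysn1] := eqVneq `|ys| 1; first exact.
  have u0 : G x - y = 0.
    apply: contrapT => /eqP u0; move: ysn1.
    rewrite eq_le ys1 /=; move: (dual_le_norm ys (G x - y)).
    by rewrite ysu normr_id -[leLHS]mul1r ler_pM2r ?normr_gt0// => ->.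
  have b0 : 0 <= b by case: bG => //; rewrite -subr_eq0 u0 eqxx.
  have [->//|ys0] := eqVneq ys 0.
  have ysp : 0 < `|ys| by rewrite normr_gt0.
  pose ys' : dual Y := `|ys|^-1 *: ys.
  have ys'b : ys' (dir_derive G x h) <= b.
    by apply: normb; [exact: normfZV|rewrite u0 normr0 linear0].
  move: ys'b; rewrite [X in X <= _](_ : _ = `|ys|^-1 * ys (dir_derive G x h))//.
  rewrite ler_pdivrMl// => /le_trans; apply.
  by rewrite -[leRHS]mul1r ler_wpM2r.
pose e := (c - b) / 2.
have e0 : 0 < e by rewrite divr_gt0// subr_gt0.
have dGe : \forall a \near 0^'+,
    `|dir_derive G x h - diff_quotient G x h a| <= e.
  by move/cvgrPdist_le : dG; exact.
near=> a.
have a0 : 0 < a by near: a; exact: nbhs_right_gt.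
have h1 : `|G x - y + a *: dir_derive G x h| <=
    `|G x - y| + a * (ys (dir_derive G x h) + e).
  by near: a; exact: ysd.
have h2 : `|dir_derive G x h - diff_quotient G x h a| <= e.
  by near: a.
rewrite diff_quotientE ?gt_eqF//.
have -> : G x + a *: diff_quotient G x h a - y =
    G x - y + a *: dir_derive G x h - a *: (dir_derive G x h - diff_quotient G x h a).
  by rewrite scalerBr opprB addrACA subrr addr0 addrAC.
rewrite (le_trans (ler_normB _ _))// normrZ gtr0_norm//.
have : a * `|dir_derive G x h - diff_quotient G x h a| <= a * e by rewrite ler_pM2l.
have : a * (ys (dir_derive G x h) + e) <= a * (b + e) by rewrite ler_pM2l// lerD2r.
have -> : a * c = a * (b + e) + a * e by rewrite /e; lra.
lra.
Unshelve. all: by end_near. Qed.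
End directional_estimates.

Section residual.
Context {R : realType} {X : topologicalType} {Y : normedModType R} {m : nat}.

(** The domain is only a topological space because the residual is used both as a
    function of x and as a function of the pair (x, p). *)
Definition residual (G : X -> Y) (f : 'I_m -> X -> R) (y : Y) (z : 'rV[R]_m)
    (x : X) : R :=
  `|G x - y| + \sum_(i < m) Num.max (f i x - z ord0 i) 0.

Lemma residual_ge0 G f y z x : 0 <= residual G f y z x.
Proof. by rewrite addr_ge0// sumr_ge0// => i _; rewrite le_max lexx orbT. Qed.

Lemma residual_eq0 G f y z x : residual G f y z x = 0 ->
  G x = y /\ forall i, f i x <= z ord0 i.
Proof.
have hge0 i : 0 <= Num.max (f i x - z ord0 i) 0 by rewrite le_max lexx orbT.
move/eqP; rewrite paddr_eq0 ?sumr_ge0// normr_eq0 subr_eq0 psumr_eq0//.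
move=> /andP[/eqP-> /allP f0]; split=> // i.
have := f0 i (mem_index_enum i); rewrite /= => /eqP fi0.
by rewrite -subr_le0 -fi0 le_max lexx.
Qed.

Lemma residual_gt0 G f y z x : 0 < residual G f y z x -> G x = y ->
  exists i, z ord0 i < f i x.
Proof.
move=> r0 Gx; apply: contrapT => nf; move: r0.
rewrite /residual Gx subrr normr0 add0r big1 ?ltxx// => i _.
by apply/max_idPr; rewrite subr_le0 leNgt; apply/negP => fi; apply: nf; exists i.
Qed.

Lemma residual_continuous G f y z : continuous G -> (forall i, continuous (f i)) ->
  continuous (residual G f y z).
Proof.
move=> cG cf x; apply: cvgD.
  by apply: cvg_norm; apply: cvgB; [exact: cG|exact: cvg_cst].
apply: cvg_big => [|i _]; first exact: add_continuous.
have : {for x, continuous (fun x => f i x - z ord0 i)}.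
  by apply: cvgB; [exact: cf|exact: cvg_cst].
move=> cfi; apply: (continuous_max cfi); exact: cst_continuous.
Qed.
End residual.

(** * Directions of decrease of the residual *)

Section descent_direction.
Context {R : realType} {X Y : normedModType R} {m : nat}.

(** A violated constraint passes the decrease c of f on to its hinge; a
    satisfied one keeps a zero hinge. *)
Lemma hinge_upper (f : X -> R) (x h : X) (z c : R) :
  (\forall a \near 0^'+, f (x + a *: h) <= f x + a * c) -> c <= 0 ->
  \forall a \near 0^'+, Num.max (f (x + a *: h) - z) 0 <=
    Num.max (f x - z) 0 + a * (if z < f x then c else 0).
Proof.
move=> fc c0.
have small : \forall a \near 0^'+, z < f x -> 0 <= f x - z + a * c.
  have [xz|zx] := ltP z (f x); last by near=> a.
  near=> a; move=> _.
  have a0 : 0 < a by near: a; exact: nbhs_right_gt.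
  have : a <= (f x - z) / (1 - c).
    by near: a; apply: nbhs_right_le; rewrite divr_gt0// ?subr_gt0//; lra.
  by rewrite ler_pdivlMr; [|lra] => ac; lra.
near=> a.
have a0 : 0 < a by near: a; exact: nbhs_right_gt.
have fa : f (x + a *: h) <= f x + a * c by near: a; exact: fc.
have ac0 : a * c <= 0 by rewrite mulr_ge0_le0// ltW.
have [zx|xz] := ltP z (f x).
  have sm : 0 <= f x - z + a * c by move: zx; near: a.
  have fz : 0 <= f x - z by rewrite subr_ge0 ltW.
  by rewrite (max_l fz) ge_max sm andbT; lra.
have fz : f x - z <= 0 by rewrite subr_le0.
by rewrite mulr0 addr0 (max_r fz) ge_max lexx andbT; lra.
Unshelve. all: by end_near. Qed.

Lemma hinge_inactive (f : X -> R) (x h : X) (z : R) :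
  {for x, continuous f} -> f x < z ->
  \forall a \near 0^'+, Num.max (f (x + a *: h) - z) 0 <= Num.max (f x - z) 0.
Proof.
move=> cf fz.
have line : (fun a : R => x + a *: h) @ 0^'+ --> x.
  rewrite -[X in _ --> X]addr0 -(scale0r h).
  apply: cvgD; first exact: cvg_cst.
  apply: cvgZr_tmp; apply: cvg_at_right_filter; exact: cvg_id.
have fline := cvg_comp _ _ line cf.
near=> a.
rewrite max_r; first by rewrite le_max lexx orbT.
rewrite subr_le0; near: a; exact: (cvgr_le _ fline).
Unshelve. all: by end_near. Qed.

Lemma residual_step (G : X -> Y) (f : 'I_m -> X -> R) (y : Y) (z : 'rV[R]_m)
    (x h : X) (b : R) (c : 'I_m -> R) :
  (\forall a \near 0^'+, `|G (x + a *: h) - y| <= `|G x - y| + a * b) ->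
  (forall i, \forall a \near 0^'+, Num.max (f i (x + a *: h) - z ord0 i) 0 <=
    Num.max (f i x - z ord0 i) 0 + a * c i) ->
  \forall a \near 0^'+, residual G f y z (x + a *: h) <=
    residual G f y z x + a * (b + \sum_(i < m) c i).
Proof.
move=> Gb /filter_forall fc; near=> a.
rewrite mulrDr mulr_sumr addrACA -big_split /=.
apply: lerD; first by near: a; exact: Gb.
by apply: ler_sum => i _; move: i; near: a.
Unshelve. all: by end_near. Qed.

Definition excess_le (e : R) (A B : set (dual X)) : Prop :=
  forall v, A v -> exists2 w, B w & `|v - w| <= e.

Lemma excess_le_pairing (e c H : R) (A B : set (dual X)) (h : X) :
  excess_le e A B -> 0 <= e -> `|h| <= H -> (forall w, B w -> w h <= c) ->
  forall v, A v -> v h <= c + e * H.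
Proof.
move=> AB e0 hH Bc v /AB[w /Bc wc vw].
have := le_trans (ler_norm _) (dual_le_norm (v - w) h).
rewrite (_ : (v - w) h = v h - w h)//.
have : `|v - w| * `|h| <= e * H by rewrite ler_pM.
lra.
Qed.

(** If G x <> y, the direction h1 + hb decreases the norm term at rate at least
    b / 2 without increasing any hinge: |h1| <= 1 and |v| <= C give v h1 <= C, which
    v hb <= - (C + 1) outweighs.  If G x = y, the direction hb decreases a violated
    constraint at rate 1 / 2 while the norm term grows at rate at most 1 / 4.  The
    error e made on the functionals costs at most e * (1 + |hb|) in both cases. *)
Lemma descent_direction (G : X -> Y) (f : 'I_m -> X -> R) (I : set 'I_m)
    (DG : dual Y -> qdpair X) (Df : 'I_m -> qdpair X)
    (A : dual Y -> set (dual X)) (B : 'I_m -> set (dual X))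
    (x hb : X) (y : Y) (z : 'rV[R]_m) (b C e : R) :
  0 < b -> 0 <= e -> e * (1 + `|hb|) <= b / 4 -> e * (1 + `|hb|) <= 1 / 8 ->
  (forall u : Y, unit_sphere Y u -> exists2 h1, `|h1| <= 1 &
     forall v, support_union A u v -> v h1 <= - b) ->
  (forall ys v, A ys v -> v hb = 0) ->
  (forall i v, I i -> B i v -> `|v| <= C /\ v hb <= - (C + 1)) ->
  is_scalar_quasidifferential G x DG ->
  (forall i, I i -> is_quasidifferential (f i) x (Df i)) ->
  (forall ys, unit_sphere (dual Y) ys -> excess_le e (qdsum (DG ys)) (A ys)) ->
  (forall i, I i -> excess_le e (qdsum (Df i)) (B i)) ->
  (forall i, ~ I i -> {for x, continuous (f i)} /\ f i x < z ord0 i) ->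
  0 < residual G f y z x ->
  exists2 h, `|h| <= 1 + `|hb| & \forall a \near 0^'+,
    residual G f y z (x + a *: h) <=
      residual G f y z x - a * Num.min (b / 2) (1 / 4).
Proof.
move=> b0 e0 eb e8 sepA A0 BC [dG qG] qf AG Bf fI res0.
set k := Num.min _ _.
have [kb k4] : k <= b / 2 /\ k <= 1 / 4 by rewrite !ge_min !lexx orbT.
have [Gxy|Gxy] := eqVneq (G x) y.
  (* Some hinge is positive, and the margin of inactive constraints makes
     the corresponding constraint active. *)
  have [i0 zi0] := residual_gt0 res0 Gxy.
  have Ii0 : I i0 by apply: contrapT => /fI[_ /lt_trans/(_ zi0)]; rewrite ltxx.
  have hbH : `|hb| <= 1 + `|hb| by rewrite lerDr.
  exists hb => //.
  pose c i := if z ord0 i < f i x then - (1 / 2) else 0 : R.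
  have cI i : \forall a \near 0^'+, Num.max (f i (x + a *: hb) - z ord0 i) 0 <=
      Num.max (f i x - z ord0 i) 0 + a * c i.
    have [Ii|nIi] := pselect (I i); last first.
      have [cfi fz] := fI i nIi.
      rewrite /c ltNge (ltW fz) /=.
      by under eq_near do rewrite mulr0 addr0; exact: hinge_inactive.
    apply: hinge_upper; last by rewrite oppr_le0.
    have [df /qd_represents_le qfi] := qf i Ii.
    apply: dir_derive_upper; first exact: df.
    apply: (@le_lt_trans _ _ (- 1 + e * (1 + `|hb|))); last lra.
    apply: qfi; apply: (excess_le_pairing (Bf i Ii)) => // w Bw.
    have [wC whb] := BC i w Ii Bw; have := normr_ge0 w; lra.
  have Gb : \forall a \near 0^'+, `|G (x + a *: hb) - y| <=
      `|G x - y| + a * (1 / 4).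
    apply: (@dir_derive_norm_upper _ _ _ _ _ _ _ (1 / 8)) => //; [lra|left; lra|].
    move=> ys ys1 _; apply: (@qd_represents_le _ _ (DG ys) _ hb) (qG ys) _ => v Dv.
    have : v hb <= 0 + e * (1 + `|hb|).
      by apply: (excess_le_pairing (AG ys ys1)) Dv => // w /A0 ->.
    lra.
  have := residual_step Gb cI; apply: filterS2 (nbhs_right_gt _) => a a0.
  move=> /le_trans; apply; rewrite lerD2l -mulrN ler_pM2l//.
  rewrite (bigD1 i0)//= {1}/c zi0.
  have : \sum_(i < m | i != i0) c i <= 0.
    by apply: sumr_le0 => i _; rewrite /c; case: ifP => // _; lra.
  lra.
have un : G x - y != 0 by rewrite subr_eq0.
have u0 : 0 < `|G x - y| by rewrite normr_gt0.
have [h1 h11 sep] := sepA (`|G x - y|^-1 *: (G x - y)) (normfZV un).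
have hH : `|h1 + hb| <= 1 + `|hb| by rewrite (le_trans (ler_normD _ _))// lerD2r.
exists (h1 + hb) => //.
have cI i : \forall a \near 0^'+, Num.max (f i (x + a *: (h1 + hb)) - z ord0 i) 0 <=
    Num.max (f i x - z ord0 i) 0 + a * 0.
  have [Ii|nIi] := pselect (I i); last first.
    have [cfi fz] := fI i nIi.
    by under eq_near do rewrite mulr0 addr0; exact: hinge_inactive.
  have := @hinge_upper (f i) x (h1 + hb) (z ord0 i) 0 _ (lexx 0).
  rewrite if_same; apply.
  have [df /qd_represents_le qfi] := qf i Ii.
  apply: dir_derive_upper; first exact: df.
  apply: (@le_lt_trans _ _ (- 1 + e * (1 + `|hb|))); last lra.
  apply: qfi; apply: (excess_le_pairing (Bf i Ii)) => // w Bw.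
  have [wC whb] := BC i w Ii Bw.
  have wh1 : w h1 <= C.
    rewrite (le_trans (ler_norm _))// (le_trans (dual_le_norm _ _))//.
    by rewrite (le_trans _ wC)// -[leRHS]mulr1 ler_wpM2l.
  by rewrite linearD -[X in X <= _]/(w h1 + w hb); lra.
have Gb : \forall a \near 0^'+, `|G (x + a *: (h1 + hb)) - y| <=
    `|G x - y| + a * (- (b / 2)).
  apply: (@dir_derive_norm_upper _ _ _ _ _ _ _ (- (3 * b / 4))) => //; [lra|by right|].
  move=> ys ys1 ysu.
  apply: (@qd_represents_le _ _ (DG ys) _ (h1 + hb)) (qG ys) _ => v Dv.
  have : v (h1 + hb) <= - b + e * (1 + `|hb|).
    apply: (excess_le_pairing (AG ys ys1)) Dv => // w Aw.
    rewrite (linearD w) /= (A0 _ _ Aw) addr0; apply: sep; exists ys => //; split => //.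
    by rewrite (linearZ_LR ys) /= ysu normfZV// -[LHS]/(_ * _) mulVf ?gt_eqF.
  lra.
have := residual_step Gb cI; apply: filterS2 (nbhs_right_gt _) => a a0.
move=> /le_trans; apply; rewrite lerD2l -mulrN ler_pM2l//.
by rewrite sumr_const mul0rn addr0 lerN2.
Qed.
End descent_direction.

(** * Estimates near the reference point *)

Lemma fin_uniform (R : realType) (n : nat) (P : 'I_n -> R -> Prop) :
  (forall i, exists2 e, 0 < e & P i e) ->
  (forall i e e', 0 < e' -> e' <= e -> P i e -> P i e') ->
  exists2 e, 0 < e & forall i, P i e.
Proof.
move=> ex mono.
have /filter_forall nP i : \forall e \near 0^'+, P i e.
  have [e e0 Pe] := ex i; near=> e'.
  by apply: mono Pe; near: e'; [exact: nbhs_right_gt|exact: nbhs_right_le].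
by near (0 : R)^'+ => e; exists e; near: e => //; exact: nbhs_right_gt.
Unshelve. all: by end_near. Qed.

Section neighbourhoods.
Context {R : realType} {X : normedModType R} {P : metricType R}.

Lemma nbhs_prod_mdist (x0 : X) (p0 : P) (A : set (X * P)) :
  nbhs (x0, p0) A <-> exists2 d : R, 0 < d &
    forall x p, `|x - x0| < d -> mdist p p0 < d -> A (x, p).
Proof.
split.
  move=> [[B C] /= [/nbhs_ballP[d /= d0 dB] /nbhs_ballP[e /= e0 eC]] BCA].
  exists (Num.min d e) => [|x p]; first by rewrite lt_min d0.
  rewrite !lt_min => /andP[xd _] /andP[_ pe]; apply: BCA; split.
    by apply: dB; rewrite -ball_normE /= distrC.
  by apply: eC; rewrite ballEmdist /= metric_sym.
move=> [d d0 dA]; exists (ball x0 d, ball p0 d); first by split; exact: nbhsx_ballx.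
move=> [x p] /= []; rewrite -ball_normE ballEmdist /= distrC metric_sym.
exact: dA.
Qed.

(** Outer semicontinuity is applied to the open e / 2-neighbourhoods of the two
    sets of the reference pair. *)
Lemma outer_semicontinuous_excess (U : set (X * P)) (D : X -> P -> qdpair X)
    (x0 : X) (p0 : P) (e : R) :
  qd_outer_semicontinuous U D x0 p0 -> 0 < e ->
  exists2 d : R, 0 < d & forall x p, U (x, p) -> `|x - x0| < d ->
    mdist p p0 < d -> excess_le e (qdsum (D x p)) (qdsum (D x0 p0)).
Proof.
move=> osc e0; have e2 : 0 < e / 2 by rewrite divr_gt0.
pose V (A : set (dual X)) := \bigcup_(v in A) ball v (e / 2).
have oV A : open (V A) by apply: bigcup_open => v _; exact: ball_open.
have sV A : A `<=` V A by move=> v Av; exists v => //; exact: ballxx.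
have [d d0 dP] := osc _ _ (oV _) (oV _) (sV (D x0 p0).1) (sV (D x0 p0).2).
exists d => // x p Uxp xd pd _ [v Dv [w Dw <-]].
have [v0 Dv0 vv0] := (dP x p Uxp xd pd).1 v Dv.
have [w0 Dw0 ww0] := (dP x p Uxp xd pd).2 w Dw.
exists (v0 + w0); first by exists v0 => //; exists w0.
move: vv0 ww0; rewrite -!ball_normE /= => vv0 ww0.
rewrite opprD addrACA (le_trans (ler_normD _ _))// [leRHS]splitr.
by rewrite lerD// distrC ltW.
Qed.

Lemma uniformly_osc_excess (Y : normedModType R)
    (D : X -> P -> dual Y -> qdpair X) (x0 : X) (p0 : P) (e : R) :
  qdsum_uniformly_osc D x0 p0 -> 0 < e ->
  exists2 d : R, 0 < d & forall x p, `|x - x0| < d -> mdist p p0 < d ->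
    forall ys, unit_sphere (dual Y) ys ->
    excess_le e (qdsum (D x p ys)) (qdsum (D x0 p0 ys)).
Proof.
move=> osc e0; have [d d0 dP] := osc e e0.
exists d => // x p xd pd ys ys1 v /(dP ys x p ys1 (ltW xd) (ltW pd)).
move=> [v0 Dv0 [w we <-]]; exists v0 => //.
by rewrite addrAC subrr add0r; move: we; rewrite /cball /= subr0.
Qed.
End neighbourhoods.

(** Half of the infimum when it is finite; when it is infinite the sets are empty or
    the sphere is, and any b will do. *)
Lemma regularity_lower_bound (R : realType) (X Y : normedModType R)
    (A : dual Y -> set (dual X)) :
  (0 < ereal_inf [set ereal_inf [set `|v|%:E | v in A ys]
                 | ys in unit_sphere (dual Y)])%E ->
  exists2 b : R, 0 < b & forall ys v, unit_sphere (dual Y) ys -> A ys v -> b < `|v|.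
Proof.
set s := ereal_inf _ => s0.
have sle ys v : unit_sphere (dual Y) ys -> A ys v -> (s <= `|v|%:E)%E.
  move=> ys1 Av; apply: ge_ereal_inf; exists (ereal_inf [set `|w|%:E | w in A ys]).
    by exists ys.
  by apply: ge_ereal_inf; exists `|v|%:E => //; exists v.
have [b b0 bs] : exists2 b : R, 0 < b & (b%:E < s)%E.
  move: s0; case: (s) => [r| |]//; rewrite ?lte_fin => r0.
    by exists (r / 2); rewrite ?lte_fin; lra.
  by exists 1; rewrite ?ltry.
by exists b => // ys v ys1 Av; rewrite -lte_fin (lt_le_trans bs)// (sle ys).
Qed.

Section metric_regularity_of_error_bound.
Context {R : realType} {X Y : normedModType R} {P : metricType R} {m : nat}.
Context (F : X * P -> Y) (g : 'I_m -> X * P -> R).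

(** The residual is at most the distance from (y, z) to the image of x: a point of
    the image has the form (F(x, p), z') with g_i(x, p) <= z'_i, so that
    max(g_i(x, p) - z_i, 0) <= |z_i - z'_i|. *)
Lemma error_bound_metric_regularity (x0 : X) (p0 : P) (K : R)
    (V : set (X * P)) (W : set (l1prod Y m)) :
  0 < K -> nbhs (x0, p0) V -> nbhs (0 : l1prod Y m) W ->
  (forall x p y z, V (x, p) -> W (y, z) ->
    (set_dist x (feasible_set F g p y z) <=
      (K * (`|F (x, p) - y| +
        \sum_(i < m) Num.max (g i (x, p) - z ord0 i) 0))%:E)%E) ->
  \forall p \near p0, metric_regularity_const (Phi F g p) x0 0 K.
Proof.
move=> K0 /nbhs_prod_mdist[d d0 dV] /nbhs_ballP[r /= r0 rW] err.
apply/nbhs_ballP; exists d => //= p; rewrite ballEmdist /= metric_sym => pd.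
split => //; exists (Num.min (d / 2) (r / 2)); first by rewrite lt_min !divr_gt0.
move=> x [y z]; rewrite /cball /= !le_min => /andP[xd _] /andP[_ wr].
have Vxp : V (x, p) by apply: dV => //; lra.
have Wyz : W (y, z).
  by apply: rW; rewrite -ball_normE /= distrC; lra.
have := err x p y z Vxp Wyz.
rewrite (_ : feasible_set F g p y z = [set u | Phi F g p u (y, z)]); last first.
  by apply/seteqP; split => u /=; rewrite /Phi /= => -[].
move=> /le_trans; apply; rewrite EFinM lee_pmul2l ?lte_fin//.
apply: le_ereal_inf_tmp => _ [[y' z'] [/= -> gz'] <-]; rewrite lee_fin.
rewrite -[X in _ <= X]/(`|y - F (x, p)| + \sum_(i < m) `|(z - z') ord0 i|).
rewrite distrC lerD2l; apply: ler_sum => i _; rewrite !mxE ge_max normr_ge0 andbT.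
by have := gz' i; have := ler_norm (z' ord0 i - z ord0 i); rewrite distrC; lra.
Qed.
End metric_regularity_of_error_bound.

(** * The local error bound *)

(** Scaling h makes its strict decrease exceed the common norm bound C of the sums,
    so that adding a vector of the unit ball to t *: h preserves a decrease of 1. *)
Lemma rescaled_direction (R : realType) (X : completeNormedModType R) (m : nat)
    (I : set 'I_m) (D : 'I_m -> qdpair X) (phi : 'I_m -> X -> R) (h : X) :
  (forall i, I i -> qd_represents (D i) (phi i)) ->
  (forall i v, I i -> qdsum (D i) v -> v h < 0) ->
  exists C t : R, forall i v, I i -> qdsum (D i) v ->
    `|v| <= C /\ v (t *: h) <= - (C + 1).
Proof.
move=> Dphi Dh.
have [||e e0 eP] := @fin_uniform R m (fun i e => I i -> forall v, qdsum (D i) v ->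
    v h <= - e /\ `|v| <= e^-1).
- move=> i; have [Ii|nIi] := pselect (I i); last by exists 1.
  have [e e0 eP] := qdsum_lt0 (Dphi i Ii) (fun v => Dh i v Ii).
  have [C C0 CP] := qdsum_bounded (Dphi i Ii).
  have C1 : 0 < (C + 1)^-1 by rewrite invr_gt0; lra.
  exists (Num.min e (C + 1)^-1); first by rewrite lt_min e0.
  move=> _ v Dv; split.
    by rewrite (le_trans (eP v Dv))// lerN2 ge_min lexx.
  rewrite (le_trans (CP v Dv))// (@le_trans _ _ (C + 1))//; first by lra.
  rewrite -[leLHS]invrK lef_pV2 ?posrE// ?ge_min ?lexx ?orbT//.
  by rewrite lt_min e0.
- move=> i e e' e'0 e'e eP Ii v Dv; have [vh ve] := eP Ii v Dv; split; first lra.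
  by rewrite (le_trans ve)// lef_pV2 ?posrE// (lt_le_trans e'0).
have ei : 0 < e^-1 by rewrite invr_gt0.
exists e^-1, ((e^-1 + 1) / e) => i v Ii Dv; have [vh ve] := eP i Ii v Dv.
split => //; rewrite (linearZ_LR v) /= -[_ *: _]/(_ * _).
have -> : - (e^-1 + 1) = (e^-1 + 1) / e * (- e) by field; rewrite gt_eqF.
by rewrite ler_pM2l// divr_gt0//; lra.
Qed.

(** Constraints inactive at t0 stay so near t0 by a common margin, hence also
    after a perturbation of the right-hand side by at most s. *)
Lemma inactive_margin (R : realType) (T : topologicalType) (m : nat)
    (g : 'I_m -> T -> R) (t0 : T) :
  (forall i, continuous (g i)) -> (forall i, g i t0 <= 0) ->
  exists2 s : R, 0 < s &
    \forall t \near t0, forall i, g i t0 <> 0 -> g i t < - s.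
Proof.
move=> cg g0.
have [||s s0 sP] := @fin_uniform R m (fun i s => g i t0 <> 0 -> g i t0 < - s).
- move=> i; have [gi|gi] := eqVneq (g i t0) 0; first by exists 1.
  have gi0 : g i t0 < 0 by rewrite lt_neqAle gi g0.
  by exists (- g i t0 / 2) => [|_]; lra.
- by move=> i e e' e'0 e'e ge /ge; lra.
exists s => //; apply: filter_forall => i.
have [gi|/eqP gi] := eqVneq (g i t0) 0; first by near=> t.
by near=> t; move=> _; near: t; apply: (cvgr_lt _ (cg i t0)); exact: sP.
Unshelve. all: by end_near. Qed.

(** Reduces smallness of the residual, jointly in all variables, to its continuity
    at y = 0, z = 0 and to the smallness of (y, z). *)
Lemma residual_perturbation (R : realType) (T : topologicalType)
    (Y : normedModType R) (m : nat) (G : T -> Y) (f : 'I_m -> T -> R)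
    (y : Y) (z : 'rV[R]_m) (t : T) :
  residual G f y z t <= residual G f 0 0 t + `|(y, z) : l1prod Y m|.
Proof.
rewrite -[X in _ + X]/(`|y| + \sum_(i < m) `|z ord0 i|) /residual subr0.
rewrite addrACA -big_split /= lerD ?ler_normB//; apply: ler_sum => i _.
rewrite mxE subr0 ge_max addr_ge0 ?le_max ?lexx ?orbT// andbT.
have := ler_norm (- z ord0 i); rewrite normrN.
have : f i t <= Num.max (f i t) 0 by rewrite le_max lexx.
lra.
Qed.

Section local_error_bound.
Context {R : realType} {X Y : completeNormedModType R} {P : metricType R} {m : nat}.
Context (F : X * P -> Y) (g : 'I_m -> X * P -> R).
Context (DF : X -> P -> dual Y -> qdpair X) (Dg : 'I_m -> X -> P -> qdpair X).
Context (xb : X) (pb : P) (U : set (X * P)).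

Let res (p : P) := residual (fun x => F (x, p)) (fun i x => g i (x, p)).

(** The descent condition of descent_error_bound, with a rate k and a
    neighbourhood common to all the parameters. *)
Lemma uniform_descent : continuous F -> (forall i, continuous (g i)) ->
  feasible_set F g pb 0 0 xb ->
  nbhs (xb, pb) U ->
  (forall x p, U (x, p) ->
     is_scalar_quasidifferential (fun u => F (u, p)) x (DF x p) /\
     forall i, active g xb pb i ->
       is_quasidifferential (fun u => g i (u, p)) x (Dg i x p)) ->
  (forall i, active g xb pb i ->
     qd_outer_semicontinuous U (Dg i) xb pb) ->
  qdsum_uniformly_osc DF xb pb ->
  (forall y : Y, unit_sphere Y y ->
     let D := support_union (fun ys => qdsum (DF xb pb ys)) y in
     closed (D : set (weak_star X)) /\
     convex_set (D : set (convex_lmodType (dual X)))) ->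
  qd_MFCQ g DF Dg xb pb ->
  exists k d s : R, [/\ 0 < k, 0 < d, 0 < s &
    forall x p y (z : 'rV[R]_m), `|x - xb| < d -> mdist p pb < d ->
      (forall i, `|z ord0 i| <= s) -> 0 < res p y z x ->
      exists2 x', x' != x & res p y z x' + k * `|x' - x| <= res p y z x].
Proof.
move=> cF cg [_ gxb] nU qd oscg oscF Dconv.
move=> [/regularity_lower_bound[b b0 Db] [h [Fh gh]]].
have [qF qg] := qd xb pb (nbhs_singleton nU).
have [C [t tP]] := rescaled_direction (fun i Ii => (qg i Ii).2) gh.
set hb := t *: h in tP.
have Fhb ys v : qdsum (DF xb pb ys) v -> v hb = 0.
  by move=> /Fh vh; rewrite (linearZ_LR v) /= vh scaler0.
have sep (u : Y) : unit_sphere Y u -> exists2 h1 : X, `|h1| <= 1 &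
    forall v, support_union (fun ys => qdsum (DF xb pb ys)) u v -> v h1 <= - b.
  move=> u1; have [cD xD] := Dconv u u1.
  apply: uniform_descent_direction => //; first exact: ltW.
  by move=> v [ys [ys1 _] /(Db ys v ys1)].
pose H := 1 + `|hb|.
have H0 : 0 < H by rewrite /H; have := normr_ge0 hb; lra.
(* This e makes the loss e * H admissible for both rates of descent. *)
pose e := Num.min (b / 4) (1 / 8) / H.
have e0 : 0 < e by rewrite divr_gt0// lt_min; lra.
have [eb e8] : e * H <= b / 4 /\ e * H <= 1 / 8.
  by rewrite divfK ?gt_eqF// !ge_min !lexx orbT.
have [d1 d10 d1P] := uniformly_osc_excess oscF e0.
have [||d2 d20 d2P] := @fin_uniform R m (fun i d => active g xb pb i ->
    forall x p, U (x, p) -> `|x - xb| < d -> mdist p pb < d ->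
    excess_le e (qdsum (Dg i x p)) (qdsum (Dg i xb pb))).
- move=> i; have [Ii|nIi] := pselect (active g xb pb i); last by exists 1.
  by have [d d0 dP] := outer_semicontinuous_excess (oscg i Ii) e0; exists d.
- move=> i d d' d'0 d'd dP Ii x p Uxp xd pd.
  by apply: dP => //; exact: lt_le_trans d'd.
have [s s0 /nbhs_prod_mdist[d3 d30 d3P]] : exists2 s : R, 0 < s &
    \forall xp \near (xb, pb), forall i, g i (xb, pb) <> 0 -> g i xp < - s.
  by apply: inactive_margin => // i; have := gxb i; rewrite mxE.
move/nbhs_prod_mdist: nU => [d4 d40 d4P].
pose d := Num.min (Num.min d1 d2) (Num.min d3 d4).
pose k := Num.min (b / 2) (1 / 4).
have k0 : 0 < k by rewrite lt_min; lra.
exists (k / H), d, s; split; [exact: divr_gt0|by rewrite !lt_min d10 d20 d30|by []|].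
move=> x p y z; rewrite !lt_min => /andP[/andP[x1 x2] /andP[x3 x4]].
move=> /andP[/andP[p1 p2] /andP[p3 p4]] zs res0.
have Uxp := d4P x p x4 p4.
have [qFx qgx] := qd x p Uxp.
have [|h' h'H desc] := @descent_direction R X Y m (fun u => F (u, p))
  (fun i u => g i (u, p)) (active g xb pb) (DF x p) (fun i => Dg i x p)
  (fun ys => qdsum (DF xb pb ys)) (fun i => qdsum (Dg i xb pb))
  x hb y z b C e b0 (ltW e0) eb e8 sep Fhb tP qFx qgx (d1P x p x1 p1)
  (fun i Ii => d2P i Ii x p Uxp x2 p2) _ res0.
  move=> i nIi; split.
    apply: (@continuous_comp _ _ _ (fun u => (u, p)) (g i)); last exact: cg.
    by apply: cvg_pair => //=; exact: cvg_cst.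
  rewrite (lt_le_trans (d3P x p x3 p3 i nIi))//.
  by have := zs i; rewrite ler_norml => /andP[].
near (0 : R)^'+ => a.
have a0 : 0 < a by near: a; exact: nbhs_right_gt.
have ra : res p y z (x + a *: h') <= res p y z x - a * k by near: a; exact: desc.
have ak : 0 < a * k by exact: mulr_gt0.
exists (x + a *: h').
  by apply: contraTneq ra => ->; rewrite -ltNge; lra.
rewrite [x + _ - x]addrAC subrr add0r normrZ gtr0_norm//.
have : k / H * (a * `|h'|) <= a * k.
  rewrite (_ : a * k = k / H * (a * H)); last by field; rewrite gt_eqF.
  by rewrite ler_pM2l ?divr_gt0// ler_pM2l.
by move=> /(lerD ra); rewrite subrK.
Unshelve. all: by end_near. Qed.

End local_error_bound.

Theorem theorem2 (R : realType) (X Y : completeNormedModType R)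
    (P : metricType R) (m : nat)
    (F : X * P -> Y) (g : 'I_m -> X * P -> R)
    (DF : X -> P -> dual Y -> qdpair X) (Dg : 'I_m -> X -> P -> qdpair X)
    (xb : X) (pb : P) (U : set (X * P)) :
  continuous F -> (forall i, continuous (g i)) ->
  feasible_set F g pb 0 0 xb ->
  nbhs (xb, pb) U ->
  (forall x p, U (x, p) ->
     is_scalar_quasidifferential (fun u => F (u, p)) x (DF x p) /\
     forall i, active g xb pb i ->
       is_quasidifferential (fun u => g i (u, p)) x (Dg i x p)) ->
  (forall i, active g xb pb i ->
     qd_outer_semicontinuous U (Dg i) xb pb) ->
  qdsum_uniformly_osc DF xb pb ->
  (forall y : Y, unit_sphere Y y ->
     let D := support_union (fun ys => qdsum (DF xb pb ys)) y in
     closed (D : set (weak_star X)) /\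
     convex_set (D : set (convex_lmodType (dual X)))) ->
  qd_MFCQ g DF Dg xb pb ->
  exists2 K : R, 0 < K &
    (exists (V : set (X * P)) (W : set (l1prod Y m)),
       [/\ nbhs (xb, pb) V, nbhs (0 : l1prod Y m) W &
         forall x p y z, V (x, p) -> W (y, z) ->
           (set_dist x (feasible_set F g p y z) <=
             (K * (`|F (x, p) - y| +
                   \sum_(i < m) Num.max (g i (x, p) - z ord0 i) 0))%:E)%E]) /\
    (\forall p \near pb,
       metrically_regular (Phi F g p) xb 0 /\
       (metric_regularity_norm (Phi F g p) xb 0%R <= K%:E)%E).
Proof.
move=> cF cg feas nU qd oscg oscF Dconv mfcq.
have [k [d [s [k0 d0 s0 descent]]]] :=
  uniform_descent cF cg feas nU qd oscg oscF Dconv mfcq.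
pose r0 := k * (d / 2) / 2.
have r00 : 0 < r0 by rewrite !divr_gt0// mulr_gt0// divr_gt0.
(* On V x W the residual stays below k * (d / 2), so that the iteration
   started at x remains in the ball of radius d around xb. *)
pose V := [set xp : X * P | residual F g 0 0 xp < r0] `&`
          [set xp : X * P | `|xp.1 - xb| < d / 2 /\ mdist xp.2 pb < d].
pose W := [set w : l1prod Y m | `|w| < Num.min s r0].
have nV : nbhs (xb, pb) V.
  apply: filterI.
    have cres : {for (xb, pb), continuous (residual F g 0 0)}.
      exact: residual_continuous.
    suff rlt : residual F g 0 0 (xb, pb) < r0.
      have : \forall xp \near (xb, pb), residual F g 0 0 xp < r0.
        exact: (cvgr_lt _ cres).
      by [].
    move: feas => [Fxb gxb]; rewrite /residual Fxb subrr normr0 add0r big1// => i _.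
    by apply/max_idPr; rewrite subr_le0.
  apply/nbhs_prod_mdist; exists (d / 2); first by rewrite divr_gt0.
  by move=> x p xd pd; split => //=; lra.
have nW : nbhs (0 : l1prod Y m) W.
  apply/nbhs_ballP; exists (Num.min s r0); first by rewrite /= lt_min s0.
  by move=> w; rewrite -ball_normE /= sub0r normrN.
have kV0 : 0 < k^-1 by rewrite invr_gt0.
have err x p y z : V (x, p) -> W (y, z) ->
    (set_dist x (feasible_set F g p y z) <=
      (k^-1 * (`|F (x, p) - y| +
        \sum_(i < m) Num.max (g i (x, p) - z ord0 i) 0))%:E)%E.
  move=> [/= res0 [xd pd]]; rewrite /W /= lt_min => /andP[ws wr].
  pose phi := residual (fun u => F (u, p)) (fun i u => g i (u, p)) y z.
  have cpair : continuous (fun u : X => (u, p)).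
    by move=> u; apply: cvg_pair => //=; exact: cvg_cst.
  have zs i : `|z ord0 i| <= s.
    apply: ltW; apply: le_lt_trans ws.
    rewrite -[leRHS]/(`|y| + \sum_(j < m) `|z ord0 j|) (bigD1 i)//=.
    by rewrite addrCA lerDl addr_ge0// sumr_ge0.
  have [|||||u phiu ux] := @descent_error_bound R X phi x k (d / 2).
  - apply: residual_continuous => [u|i u].
      by apply: (@continuous_comp _ _ _ (fun u => (u, p)) F); [exact: cpair|exact: cF].
    by apply: (@continuous_comp _ _ _ (fun u => (u, p)) (g i)); [exact: cpair|exact: cg].
  - by move=> u; exact: residual_ge0.
  - by [].
  - have : phi x <= residual F g 0 0 (x, p) + `|(y, z) : l1prod Y m|.
      exact: (residual_perturbation F g y z (x, p)).
    by rewrite /r0 in res0 wr; lra.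
  - move=> u ud phi0; apply: descent => //.
    by have := ler_distD x u xb; lra.
  have [Fu gu] := residual_eq0 phiu.
  apply: ge_ereal_inf; exists `|x - u|%:E; first by exists u.
  by rewrite lee_fin distrC ler_pdivlMl.
exists k^-1 => //; split; first by exists V, W.
have := error_bound_metric_regularity kV0 nV nW err.
apply: filterS => p regp; split; first by exists k^-1.
by apply: ge_ereal_inf; exists (k^-1)%:E => //; exists k^-1.
Qed.
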